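(* Let $T$ be a complete theory of valued fields, possibly in a language expanding the language of valued fields, and work in a monster model $\mathcal U$ of $T$. Assume $T$ satisfies: (SE) the residue field and the value group are stably embedded; and (Im) whenever $K\models T$ and $a\in\mathcal U$ is a single element such that the valued field extension $K(a)/K$ is immediate, the type $\mathrm{tp}(a/K)$ is implied by the formulas in it of the form $\phi(x;c)$ with $c\in K$ and $\phi(x;y)$ an NIP formula. Then $T$ is NIP if and only if the theory of the residue field and the theory of the value group (each with the structure induced from $T$) are NIP.
   Context: A definable set $D$ is stably embedded if for every formula $\phi(x;y)$, with $y$ a finite tuple of variables of the sort of $D$, there is a formula $d\phi(z;y)$ such that for every $a\in\mathcal U^{|x|}$ there is $b\in D^{|z|}$ with $\phi(a;D)=d\phi(b;D)$. An extension of valued fields is immediate if it has the same value group and the same residue field. *)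

(* Defs.v *)
From HB Require Import structures.
From mathcomp Require Import all_boot all_order all_algebra.
From mathcomp Require Import boolp classical_sets functions cardinality.

Set Implicit Arguments.
Unset Strict Implicit.
Unset Printing Implicit Defensive.

Import Order.TTheory GRing.Theory Num.Theory.
Local Open Scope classical_set_scope.
Local Open Scope card_scope.

(* A tuple of elements whose sorts are listed by [X]. *)
Fixpoint env (S : Type) (C : S -> Type) (X : seq S) : Type :=
  if X is s :: X' then (C s * env C X')%type else unit.

Fixpoint env_cat (S : Type) (C : S -> Type) (X Y : seq S) :
    env C X -> env C Y -> env C (X ++ Y) :=
  match X return env C X -> env C Y -> env C (X ++ Y) with
  | [::] => fun _ b => b
  | _ :: _ => fun a b => (a.1, env_cat a.2 b)
  end.

Fixpoint env_map (S : Type) (C D : S -> Type) (f : forall s, C s -> D s)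
    (X : seq S) : env C X -> env D X :=
  match X return env C X -> env D X with
  | [::] => fun _ => tt
  | _ :: _ => fun a => (f _ a.1, env_map f a.2)
  end.

(* A set of elements of a many-sorted structure, of arbitrary sorts, is a set
   in the total space [{s : S & C s}]. *)
Fixpoint env_in (S : Type) (C : S -> Type) (A : set {s : S & C s})
    (X : seq S) : env C X -> Prop :=
  match X return env C X -> Prop with
  | [::] => fun _ => True
  | s :: _ => fun a => A (existT _ s a.1) /\ env_in A a.2
  end.

Record language (S : Type) := Language {
  func : Type;
  fdom : func -> seq S;
  fcod : func -> S;
  rel : Type;
  rdom : rel -> seq S }.

(* Constants are functions [f] with [fdom f = [::]]. *)
Record structure (S : Type) (L : language S) := Structure {
  carrier :> S -> Type;
  fint : forall f : func L, env carrier (fdom f) -> carrier (fcod f);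
  rint : forall r : rel L, env carrier (rdom r) -> Prop }.

(* De Bruijn variables of sort [s] in a context [X]. *)
Inductive var (S : Type) : seq S -> S -> Type :=
| VZ (s : S) (X : seq S) : var (s :: X) s
| VS (t : S) (X : seq S) (s : S) : var X s -> var (t :: X) s.

Inductive term (S : Type) (L : language S) (X : seq S) : S -> Type :=
| Var (s : S) : var X s -> term L X s
| App (f : func L) : terms L X (fdom f) -> term L X (fcod f)
with terms (S : Type) (L : language S) (X : seq S) : seq S -> Type :=
| TNil : terms L X [::]
| TCons (s : S) (Y : seq S) :
    term L X s -> terms L X Y -> terms L X (s :: Y).

(* The logic is classical, so these connectives suffice. *)
Inductive formula (S : Type) (L : language S) : seq S -> Type :=
| FEq (X : seq S) (s : S) : term L X s -> term L X s -> formula L X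
| FRel (X : seq S) (r : rel L) : terms L X (rdom r) -> formula L X
| FBot (X : seq S) : formula L X
| FImp (X : seq S) : formula L X -> formula L X -> formula L X
| FAll (X : seq S) (s : S) : formula L (s :: X) -> formula L X.

Arguments FBot {S L X}.

Definition FNot (S : Type) (L : language S) (X : seq S) (phi : formula L X) :=
  FImp phi FBot.

Fixpoint lookup (S : Type) (C : S -> Type) (X : seq S) (s : S)
    (x : var X s) : env C X -> C s :=
  match x in var X s return env C X -> C s with
  | VZ _ _ => fun e => e.1
  | VS _ _ _ y => fun e => lookup y e.2
  end.

Fixpoint eval (S : Type) (L : language S) (M : structure L) (X : seq S)
    (e : env M X) (s : S) (t : term L X s) : M s :=
  match t in term _ _ s return M s with
  | Var _ x => lookup x e
  | App f ts => fint (evals e ts)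
  end
with evals (S : Type) (L : language S) (M : structure L) (X : seq S)
    (e : env M X) (Y : seq S) (ts : terms L X Y) : env M Y :=
  match ts in terms _ _ Y return env M Y with
  | TNil => tt
  | TCons _ _ t ts' => (eval e t, evals e ts')
  end.

Fixpoint holds (S : Type) (L : language S) (M : structure L) (X : seq S)
    (phi : formula L X) : env M X -> Prop :=
  match phi in formula _ X return env M X -> Prop with
  | FEq _ _ t u => fun e => eval e t = eval e u
  | FRel _ _ ts => fun e => rint (evals e ts)
  | FBot _ => fun _ => False
  | FImp _ phi1 phi2 => fun e => holds phi1 e -> holds phi2 e
  | FAll _ s phi1 => fun e => forall a : M s, @holds _ _ M _ phi1 (a, e)
  end.

Definition sentence (S : Type) (L : language S) := formula L [::].

Definition theory (S : Type) (L : language S) := set (sentence L).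

Definition satisfies (S : Type) (L : language S) (M : structure L)
    (sigma : sentence L) : Prop :=
  @holds S L M [::] sigma tt.

Definition models (S : Type) (L : language S) (M : structure L)
    (T : theory L) : Prop :=
  forall sigma, T sigma -> satisfies M sigma.

Definition entails (S : Type) (L : language S) (T : theory L)
    (sigma : sentence L) : Prop :=
  forall M : structure L, models M T -> satisfies M sigma.

Definition complete (S : Type) (L : language S) (T : theory L) : Prop :=
  (exists M : structure L, models M T) /\
  (forall sigma, entails T sigma \/ entails T (FNot sigma)).

Definition Th (S : Type) (L : language S) (M : structure L) : theory L :=
  [set sigma | satisfies M sigma].

(* If [j] is an elementary embedding of [N] into [U], its image is an
   elementary substructure of [U], and all of them arise in this way. *)
Definition elementary_embedding (S : Type) (L : language S)
    (N U : structure L) (j : forall s, N s -> U s) : Prop :=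
  forall (X : seq S) (phi : formula L X) (e : env N X),
    holds phi e <-> holds phi (env_map j e).

Definition automorphism (S : Type) (L : language S) (U : structure L)
    (f : forall s, U s -> U s) : Prop :=
  [/\ forall s, bijective (f s),
      forall (g : func L) (e : env U (fdom g)),
        f _ (fint e) = fint (env_map f e)
    & forall (r : rel L) (e : env U (rdom r)),
        rint e <-> rint (env_map f e)].

(* In [phi : formula L (X ++ Y)] the free variables are partitioned as
   [phi(x; y)], with [x] of sorts [X] and [y] of sorts [Y]. *)
Definition NIP_formula (S : Type) (L : language S) (T : theory L)
    (X Y : seq S) (phi : formula L (X ++ Y)) : Prop :=
  forall M : structure L, models M T ->
  ~ exists (a : nat -> env M X) (b : set nat -> env M Y),
      forall (i : nat) (I : set nat), holds phi (env_cat (a i) (b I)) <-> I i.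

Definition NIP (S : Type) (L : language S) (T : theory L) : Prop :=
  forall (X Y : seq S) (phi : formula L (X ++ Y)), NIP_formula T phi.

Section Monster.

Variables (S : Type) (L : language S) (kappa : Type) (U : structure L).

Definition small (V : Type) (A : set V) : Prop := ~ ([set: kappa] #<= A).

(* Every cardinal below that of [kappa] is the cardinal of a subset of
   [kappa]. *)
Definition strong_limit : Prop :=
  forall A : set kappa, small A -> small [set B : set kappa | B `<=` A].

(* A formula together with the tuple of its parameters, its only remaining free
   variable being of sort [s]. *)
Definition pformula (s : S) := {Y : seq S & (formula L (s :: Y) * env U Y)%type}.

Definition pholds (s : S) (q : pformula s) (x : U s) : Prop :=
  @holds S L U (s :: projT1 q) (projT2 q).1 (x, (projT2 q).2).

Definition saturated : Prop :=
  forall (A : set {s : S & U s}) (s : S) (p : set (pformula s)),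
    small A ->
    (forall q, p q -> env_in A (projT2 q).2) ->
    (forall p0 : set (pformula s), p0 `<=` p -> finite_set p0 ->
       exists x : U s, forall q, p0 q -> pholds q x) ->
    exists x : U s, forall q, p q -> pholds q x.

(* Only the values of [f] on [A] matter. *)
Definition strongly_homogeneous : Prop :=
  forall (A : set {s : S & U s}) (f : forall s, U s -> U s),
    small A ->
    (forall (X : seq S) (phi : formula L X) (e : env U X), env_in A e ->
       (holds phi e <-> holds phi (env_map f e))) ->
    exists g : forall s, U s -> U s, automorphism g /\
      forall (s : S) (x : U s), A (existT _ s x) -> g s x = f s x.

Definition monster (T : theory L) : Prop :=
  [/\ small [set: {X : seq S & formula L X}], strong_limit,
      models U T, saturated & strongly_homogeneous].

End Monster.

Section Sort.

Variables (S : Type) (L : language S) (U : structure L) (D : S).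

Definition stably_embedded : Prop :=
  forall (X : seq S) (n : nat) (phi : formula L (X ++ nseq n D)),
  exists (m : nat) (dphi : formula L (nseq m D ++ nseq n D)),
  forall a : env U X, exists b : env U (nseq m D),
  forall d : env U (nseq n D),
    holds phi (env_cat a d) <-> holds dphi (env_cat b d).

(* One relation symbol for each subset of some [D^n] definable in [U] without
   parameters. *)
Definition induced_language : language unit :=
  @Language unit Empty_set (fun _ => [::]) (fun _ => tt)
    {n : nat & formula L (nseq n D)} (fun r => nseq (projT1 r) tt).

Fixpoint env_of_unit (n : nat) :
    env (fun _ : unit => U D) (nseq n tt) -> env U (nseq n D) :=
  match n return env (fun _ : unit => U D) (nseq n tt) -> env U (nseq n D) with
  | 0 => fun _ => tt
  | n'.+1 => fun a => (a.1, env_of_unit a.2)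
  end.

Definition induced : structure induced_language :=
  @Structure unit induced_language (fun _ => U D)
    (fun f => match f with end)
    (fun r a => holds (projT2 r) (env_of_unit a)).

End Sort.

(* [r] is only meaningful on the valuation ring and [v] away from zero; as
   total functions they take the value zero elsewhere. *)
Record is_valuation (F k : fieldType) (G : porderZmodType)
    (v : F -> G) (r : F -> k) : Prop := IsValuation {
  val_group_total : forall x y : G, (x <= y)%R || (y <= x)%R;
  val_group_leD : forall x y z : G, (x <= y)%R -> (x + z <= y + z)%R;
  val0 : v 0%R = 0%R;
  valM : forall x y : F, x != 0%R -> y != 0%R -> v (x * y)%R = (v x + v y)%R;
  valD : forall x y : F, x != 0%R -> y != 0%R -> (x + y)%R != 0%R ->
    (v x <= v (x + y))%R || (v y <= v (x + y))%R;
  val_surj : forall g : G, exists2 x : F, x != 0%R & v x = g;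
  res_out : forall x : F, ~~ (0 <= v x)%R -> r x = 0%R;
  res1 : r 1%R = 1%R;
  resD : forall x y : F, (0 <= v x)%R -> (0 <= v y)%R ->
    r (x + y)%R = (r x + r y)%R;
  resM : forall x y : F, (0 <= v x)%R -> (0 <= v y)%R ->
    r (x * y)%R = (r x * r y)%R;
  res_surj : forall c : k, exists2 x : F, (0 <= v x)%R & r x = c;
  res_eq0 : forall x : F, (0 <= v x)%R ->
    (r x = 0%R <-> x = 0%R \/ (0 < v x)%R) }.

(* The sort [VG] has no point at infinity. *)
Inductive vf_sort := VF | RF | VG.

Inductive vf_func :=
| VF0 | VF1 | VFadd | VFopp | VFmul
| RF0 | RF1 | RFadd | RFopp | RFmul
| VG0 | VGadd | VGopp
| Val | Res.

Inductive vf_rel := VGle.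

Definition vf_fdom (f : vf_func) : seq vf_sort :=
  match f with
  | VF0 | VF1 | RF0 | RF1 | VG0 => [::]
  | VFadd | VFmul => [:: VF; VF]
  | RFadd | RFmul => [:: RF; RF]
  | VGadd => [:: VG; VG]
  | VFopp | Val | Res => [:: VF]
  | RFopp => [:: RF]
  | VGopp => [:: VG]
  end.

Definition vf_fcod (f : vf_func) : vf_sort :=
  match f with
  | VF0 | VF1 | VFadd | VFopp | VFmul => VF
  | RF0 | RF1 | RFadd | RFopp | RFmul | Res => RF
  | VG0 | VGadd | VGopp | Val => VG
  end.

(* Up to renaming symbols, every expansion of the three-sorted language of
   valued fields (without new sorts) is of this form. *)
Definition vf_language (E : language vf_sort) : language vf_sort :=
  @Language vf_sort
    (vf_func + func E)
    (fun f => match f with inl g => vf_fdom g | inr g => fdom g end)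
    (fun f => match f with inl g => vf_fcod g | inr g => fcod g end)
    (vf_rel + rel E)
    (fun r => match r with inl _ => [:: VG; VG] | inr q => rdom q end).

Section ValuedFieldStructure.

Variables (E : language vf_sort) (M : structure (vf_language E)).

Definition vf_int (f : vf_func) : env M (vf_fdom f) -> M (vf_fcod f) :=
  @fint vf_sort (vf_language E) M (inl f).

Definition vf_zero : M VF := @vf_int VF0 tt.
Definition vf_one : M VF := @vf_int VF1 tt.
Definition vf_add (x y : M VF) : M VF := @vf_int VFadd (x, (y, tt)).
Definition vf_opp (x : M VF) : M VF := @vf_int VFopp (x, tt).
Definition vf_mul (x y : M VF) : M VF := @vf_int VFmul (x, (y, tt)).
Definition rf_zero : M RF := @vf_int RF0 tt.
Definition rf_one : M RF := @vf_int RF1 tt.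
Definition rf_add (x y : M RF) : M RF := @vf_int RFadd (x, (y, tt)).
Definition rf_opp (x : M RF) : M RF := @vf_int RFopp (x, tt).
Definition rf_mul (x y : M RF) : M RF := @vf_int RFmul (x, (y, tt)).
Definition vg_zero : M VG := @vf_int VG0 tt.
Definition vg_add (x y : M VG) : M VG := @vf_int VGadd (x, (y, tt)).
Definition vg_opp (x : M VG) : M VG := @vf_int VGopp (x, tt).
Definition vf_val (x : M VF) : M VG := @vf_int Val (x, tt).
Definition vf_res (x : M VF) : M RF := @vf_int Res (x, tt).
Definition vg_le (x y : M VG) : Prop :=
  @rint vf_sort (vf_language E) M (inl VGle) (x, (y, tt)).

(* The reduct of [M] to the language of valued fields is, up to isomorphism, a
   field with a valuation. *)
Definition valued_field : Prop :=
  exists (F k : fieldType) (G : porderZmodType) (v : F -> G) (r : F -> k)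
    (iF : M VF -> F) (ik : M RF -> k) (iG : M VG -> G),
  is_valuation v r /\
  [/\ bijective iF, bijective ik & bijective iG] /\
  [/\ iF vf_zero = 0%R, iF vf_one = 1%R,
      forall x y, iF (vf_add x y) = (iF x + iF y)%R,
      forall x, iF (vf_opp x) = (- iF x)%R
    & forall x y, iF (vf_mul x y) = (iF x * iF y)%R] /\
  [/\ ik rf_zero = 0%R, ik rf_one = 1%R,
      forall x y, ik (rf_add x y) = (ik x + ik y)%R,
      forall x, ik (rf_opp x) = (- ik x)%R
    & forall x y, ik (rf_mul x y) = (ik x * ik y)%R] /\
  [/\ iG vg_zero = 0%R,
      forall x y, iG (vg_add x y) = (iG x + iG y)%R,
      forall x, iG (vg_opp x) = (- iG x)%R
    & forall x y, vg_le x y <-> (iG x <= iG y)%R] /\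
  (forall x, iG (vf_val x) = v (iF x)) /\
  (forall x, ik (vf_res x) = r (iF x)).

Inductive subfield (A : set (M VF)) : M VF -> Prop :=
| subfield_gen x : A x -> subfield A x
| subfield0 : subfield A vf_zero
| subfield1 : subfield A vf_one
| subfieldD x y : subfield A x -> subfield A y -> subfield A (vf_add x y)
| subfieldN x : subfield A x -> subfield A (vf_opp x)
| subfieldM x y : subfield A x -> subfield A y -> subfield A (vf_mul x y)
| subfieldV x y : subfield A x -> vf_mul x y = vf_one -> subfield A y.

Definition value_group (K : set (M VF)) : set (M VG) :=
  [set vf_val x | x in [set x | K x /\ x <> vf_zero]].

Definition residue_field (K : set (M VF)) : set (M RF) :=
  [set vf_res x | x in [set x | K x /\ vg_le vg_zero (vf_val x)]].

Definition immediate (K K' : set (M VF)) : Prop :=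
  [/\ K `<=` K', value_group K' = value_group K
    & residue_field K' = residue_field K].

End ValuedFieldStructure.

(* The small models [K] of [T] inside [U] are the images of elementary
   embeddings [j] of small structures. As [U] is saturated, a partial type over
   [K] implies another iff every realization in [U] of the former realizes the
   latter. *)
Definition immediate_types_NIP (E : language vf_sort)
    (T : theory (vf_language E)) (kappa : Type)
    (U : structure (vf_language E)) : Prop :=
  forall (N : structure (vf_language E)) (j : forall s, N s -> U s),
    small kappa [set: {s : vf_sort & N s}] ->
    elementary_embedding j ->
  forall a : U VF,
    immediate (range (j VF)) (subfield (range (j VF) `|` [set a])) ->
  forall a' : U VF,
    (forall (Y : seq vf_sort) (phi : formula (vf_language E) ([:: VF] ++ Y))
        (c : env N Y),
      NIP_formula T phi ->
      @holds _ _ U _ phi (a, env_map j c) ->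
      @holds _ _ U _ phi (a', env_map j c)) ->
  forall (Y : seq vf_sort) (psi : formula (vf_language E) ([:: VF] ++ Y))
      (c : env N Y),
    @holds _ _ U _ psi (a, env_map j c) ->
    @holds _ _ U _ psi (a', env_map j c).

(* Main.v *)
Require Import Defs.
From Stdlib Require List.
From mathcomp Require Import all_boot all_order all_algebra.
From mathcomp Require Import boolp classical_sets functions cardinality.

(* If some relation phi(x; y) in one variable x of the
   field sort is not NIP, there are an element a and an indiscernible sequence
   (c_i) such that phi(a; c_i) holds exactly for even i. Extend c_0 step by step
   by witnesses of formulas, and by elements of the residue field and of the
   value group that are definable over a and c_0, keeping such an alternating
   sequence. The second kind of step uses that relations with parameters in
   these two sorts are NIP, by stable embeddedness: new data attached to the
   even terms cannot tell infinitely many even places from odd ones. In the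
   limit c_0 becomes a model K, the extension K(a)/K is immediate, and phi(x; c_0)
   is still not implied by the NIP formulas in tp(a/K), since these are
   eventually constant along the sequence; this contradicts (Im). Relations in
   several variables are reduced to one variable by the same exchange argument. *)

Set Implicit Arguments.
Unset Strict Implicit.
Unset Printing Implicit Defensive.

Local Open Scope classical_set_scope.
Local Open Scope card_scope.

(** * Environments and renaming *)

(* No step of the construction keeps a or the sequence: attaching new data destroys
   indiscernibility, and restoring it by Ramsey's theorem and compactness replaces both. So the
   model cannot be built by iterating infinitely many steps. Instead the set of names is fixed at
   the outset, namely all Skolem terms in the variables of c_0, and a term of the sequence is an
   assignment of elements to all names, with arbitrary values at names not yet treated. Finitely
   many Henkin axioms are met at a time, and one last use of compactness gives all of them together.
   To survive this limit, the failure of implication has to be a family of definable conditions on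
   the pair formed by a and c_0, one for each finite list of NIP relations; [wild] is such a
   condition, stated as an implication so that it can be imposed before it is known which relations
   will hold. Assignments are infinite tuples, so definability is set up for arbitrary spaces of
   tuples, through their coordinate functions. *)
Scheme term_mut := Induction for term Sort Prop
  with terms_mut := Induction for terms Sort Prop.

Section Environments.

Variable S : Type.
Implicit Types (C D : S -> Type) (X Y Z : seq S).

(** Inversion on a variable of a nonempty context, in a form that computes on [VZ] and [VS]. Sorts
    form an arbitrary type, so the index equations cannot be solved by decidable equality. *)
Definition var_cons_case (s : S) X (P : forall t, var (s :: X) t -> Type)
    (PZ : P s (VZ s X)) (PS : forall t (y : var X t), P t (VS s y)) :
    forall t (x : var (s :: X) t), P t x :=
  fun t x =>
  match x as x0 in var W t0 return
    match W as W0 return forall t1, var W0 t1 -> Type with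
    | [::] => fun _ _ => unit
    | s0 :: X0 => fun t1 x1 =>
        forall (Q : forall u, var (s0 :: X0) u -> Type),
        Q s0 (VZ s0 X0) -> (forall u (y : var X0 u), Q u (VS s0 y)) -> Q t1 x1
    end t0 x0
  with
  | VZ _ _ => fun _ QZ _ => QZ
  | VS _ _ _ y => fun _ _ QS => QS _ y
  end P PZ PS.

Lemma var_nil_case (s : S) (x : var [::] s) : False.
Proof.
have H X t (y : var X t) : if X is [::] then False else True by case: y.
exact: (H _ _ x).
Qed.

Fixpoint env_tab C X : (forall s, var X s -> C s) -> env C X :=
  match X return (forall s, var X s -> C s) -> env C X with
  | [::] => fun _ => tt
  | s :: X' => fun f => (f s (VZ s X'), env_tab (fun t x => f t (VS s x)))
  end.

Lemma lookup_tab C X (f : forall s, var X s -> C s) s (x : var X s) :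
  lookup x (env_tab f) = f s x.
Proof. by elim: x f => //= t Y {}s x IH f; rewrite IH. Qed.

Lemma env_ext C X (a b : env C X) :
  (forall s (x : var X s), lookup x a = lookup x b) -> a = b.
Proof.
elim: X a b => [[] []//|s X IH [a1 a2] [b1 b2] H].
congr (_, _); first exact: (H _ (VZ s X)).
by apply: IH => t x; exact: (H _ (VS s x)).
Qed.

Lemma tab_lookup C X (a : env C X) : env_tab (fun s x => lookup x a) = a.
Proof. by apply: env_ext => s x; rewrite lookup_tab. Qed.

Lemma lookup_map C D (f : forall s, C s -> D s) X (a : env C X) s
  (x : var X s) : lookup x (env_map f a) = f s (lookup x a).
Proof. by elim: x a => //= t Y {}s x IH a; rewrite IH. Qed.

Lemma env_map_comp C D E (f : forall s, C s -> D s) (g : forall s, D s -> E s)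
  X (a : env C X) : env_map g (env_map f a) = env_map (fun s x => g s (f s x)) a.
Proof. by elim: X a => //= s X IH a; rewrite IH. Qed.

Fixpoint vinl X Y s (x : var X s) : var (X ++ Y) s :=
  match x in var X s return var (X ++ Y) s with
  | VZ s X' => VZ s (X' ++ Y)
  | VS t X' s y => VS t (vinl Y y)
  end.

Fixpoint vinr X Y s (y : var Y s) : var (X ++ Y) s :=
  match X return var (X ++ Y) s with
  | [::] => y
  | t :: X' => VS t (vinr X' y)
  end.

Lemma lookup_catl C X Y (a : env C X) (b : env C Y) s (x : var X s) :
  lookup (vinl Y x) (env_cat a b) = lookup x a.
Proof. by elim: x a => //= t X' {}s x IH a; rewrite IH. Qed.

Lemma lookup_catr C X Y (a : env C X) (b : env C Y) s (y : var Y s) :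
  lookup (vinr X y) (env_cat a b) = lookup y b.
Proof. by elim: X a => //= t X IH a; rewrite IH. Qed.

Lemma var_cat_case X Y (P : forall t, var (X ++ Y) t -> Prop) :
  (forall t (x : var X t), P t (vinl Y x)) ->
  (forall t (y : var Y t), P t (vinr X y)) ->
  forall t (z : var (X ++ Y) t), P t z.
Proof.
elim: X P => [|s X IH] P Pl Pr; first exact: Pr.
apply: var_cons_case; first exact: (Pl _ (VZ s X)).
by apply: IH => t x; [exact: (Pl _ (VS s x))|exact: Pr].
Qed.

Lemma env_map_cat C D (f : forall s, C s -> D s) X Y (a : env C X) (b : env C Y) :
  env_map f (env_cat a b) = env_cat (env_map f a) (env_map f b).
Proof. by elim: X a => //= s X IH a; rewrite IH. Qed.

Definition pull C X Y (r : forall s, var X s -> var Y s) (e : env C Y) :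
  env C X := env_tab (fun s x => lookup (r s x) e).

Lemma lookup_pull C X Y (r : forall s, var X s -> var Y s) (e : env C Y) s
  (x : var X s) : lookup x (pull r e) = lookup (r s x) e.
Proof. exact: lookup_tab. Qed.

Lemma pull_vinl C X Y (a : env C X) (b : env C Y) :
  pull (fun s => @vinl X Y s) (env_cat a b) = a.
Proof. by apply: env_ext => s x; rewrite lookup_pull lookup_catl. Qed.

Lemma pull_vinr C X Y (a : env C X) (b : env C Y) :
  pull (fun s => @vinr X Y s) (env_cat a b) = b.
Proof. by apply: env_ext => s x; rewrite lookup_pull lookup_catr. Qed.

Lemma env_cat_pull C X Y (e : env C (X ++ Y)) :
  env_cat (pull (fun s => @vinl X Y s) e) (pull (fun s => @vinr X Y s) e) = e.
Proof.
apply: env_ext; apply: var_cat_case => s x.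
  by rewrite lookup_catl lookup_pull.
by rewrite lookup_catr lookup_pull.
Qed.

Lemma pull_map C D (f : forall s, C s -> D s) X Y
  (r : forall s, var X s -> var Y s) (e : env C Y) :
  pull r (env_map f e) = env_map f (pull r e).
Proof.
by apply: env_ext => s x; rewrite lookup_pull !lookup_map lookup_pull.
Qed.

Lemma vswap X Y : exists r : forall s, var (X ++ Y) s -> var (Y ++ X) s,
  forall C (a : env C X) (b : env C Y), pull r (env_cat b a) = env_cat a b.
Proof.
have H s (x : var (X ++ Y) s) : exists y : var (Y ++ X) s,
    forall C (a : env C X) (b : env C Y),
      lookup y (env_cat b a) = lookup x (env_cat a b).
  apply: (@var_cat_case X Y (fun s x => exists y : var (Y ++ X) s,
    forall C (a : env C X) (b : env C Y),
      lookup y (env_cat b a) = lookup x (env_cat a b))) => {s x} s x.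
    by exists (vinr Y x) => C a b; rewrite lookup_catr lookup_catl.
  by exists (vinl X x) => C a b; rewrite lookup_catr lookup_catl.
exists (fun s x => projT1 (cid (H s x))) => C a b.
by apply: env_ext => s x; rewrite lookup_pull; case: cid => y /= ->.
Qed.

Definition rlift (t : S) X Y (r : forall s, var X s -> var Y s) :
    forall s, var (t :: X) s -> var (t :: Y) s :=
  @var_cons_case t X (fun s _ => var (t :: Y) s) (VZ t Y)
    (fun s x => VS t (r s x)).

Lemma pull_rlift C t X Y (r : forall s, var X s -> var Y s) (u : C t)
  (e : env C Y) : @pull C _ _ (rlift r) ((u, e) : env C (t :: Y)) =
    ((u, pull r e) : env C (t :: X)).
Proof.
apply: env_ext; apply: (@var_cons_case t X) => [|s x] //=.
Qed.

End Environments.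

Section Renaming.

Variables (S : Type) (L : language S).
Implicit Types (X Y Z : seq S).

Fixpoint tren X Y (r : forall s, var X s -> var Y s) s (t : term L X s) :
    term L Y s :=
  match t in term _ _ s return term L Y s with
  | Var _ x => Var L (r _ x)
  | App f ts => App (tsren r ts)
  end
with tsren X Y (r : forall s, var X s -> var Y s) Z (ts : terms L X Z) :
    terms L Y Z :=
  match ts in terms _ _ Z return terms L Y Z with
  | TNil => TNil L Y
  | TCons _ _ t ts' => TCons (tren r t) (tsren r ts')
  end.

Fixpoint fren X (phi : formula L X) :
    forall Y, (forall s, var X s -> var Y s) -> formula L Y :=
  match phi in formula _ X
    return forall Y, (forall s, var X s -> var Y s) -> formula L Y with
  | FEq _ _ t u => fun Y r => FEq (tren r t) (tren r u)
  | FRel _ q ts => fun Y r => FRel (tsren r ts)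
  | FBot _ => fun Y r => FBot
  | FImp _ p q => fun Y r => FImp (fren p r) (fren q r)
  | FAll _ s p => fun Y r => FAll (fren p (rlift (t := s) r))
  end.

Variable M : structure L.

Lemma eval_tren X Y (r : forall s, var X s -> var Y s) (e : env M Y) s
  (t : term L X s) : eval e (tren r t) = eval (pull r e) t.
Proof.
pattern s, t; apply: (@term_mut S L X _
  (fun Z ts => evals e (tsren r ts) = evals (pull r e) ts)) => //=.
- by move=> u x; rewrite lookup_pull.
- by move=> f ts ->.
- by move=> u Z v -> ts ->.
Qed.

Lemma evals_tsren X Y (r : forall s, var X s -> var Y s) (e : env M Y) Z
  (ts : terms L X Z) : evals e (tsren r ts) = evals (pull r e) ts.
Proof. by elim: ts => //= s W t ts ->; rewrite eval_tren. Qed.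

Lemma holds_fren X (phi : formula L X) Y (r : forall s, var X s -> var Y s)
  (e : env M Y) : holds (fren phi r) e <-> holds phi (pull r e).
Proof.
elim: phi Y r e => {X} /=.
- by move=> X s t u Y r e; rewrite !eval_tren.
- by move=> X q ts Y r e; rewrite evals_tsren.
- by [].
- by move=> X p IHp q IHq Y r e; rewrite IHp IHq.
- move=> X s p IH Y r e.
  by split=> H u; have := H u; rewrite IH pull_rlift.
Qed.

Fixpoint FAlls X Y : formula L (X ++ Y) -> formula L Y :=
  match X return formula L (X ++ Y) -> formula L Y with
  | [::] => fun p => p
  | _ :: _ => fun p => FAlls (FAll p)
  end.

Lemma holds_FAlls X Y (p : formula L (X ++ Y)) (e : env M Y) :
  holds (FAlls p) e <-> forall a : env M X, holds p (env_cat a e).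
Proof.
elim: X p => [|s X IH] p /=; first by split=> [H []//|H]; exact: (H tt).
rewrite IH /=; split=> [H [a1 a2]|H a u]; first exact: H.
exact: (H (u, a)).
Qed.

End Renaming.

(** * Definable sets *)

Definition asg (S : Type) (C V : S -> Type) := forall s, V s -> C s.

(* The points of [T] are tuples, possibly infinite, of elements of [U]; they are
   presented by their coordinate functions. *)
Class Crd (S : Type) (L : language S) (U : structure L) (T : Type) :=
  crd : forall s, (T -> U s) -> Prop.

Section Definability.

Variables (S : Type) (L : language S) (U : structure L).
Implicit Types (X Y Z : seq S).

(** An inductive family, because the identity of [U s0] is a function into [U s] only after [s] is
    identified with [s0]. *)
Inductive crd_sort_rel (s0 : S) : forall s, (U s0 -> U s) -> Prop :=
  CrdSort : crd_sort_rel (fun u : U s0 => u).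

Definition env_crd X : Crd U (env U X) :=
  fun s h => exists x : var X s, h = lookup x.

Definition asg_crd (V : S -> Type) : Crd U (asg U V) :=
  fun s h => exists v : V s, h = fun e => e s v.

Definition sort_crd s0 : Crd U (U s0) := @crd_sort_rel s0.

Definition prod_crd T1 T2 (C1 : Crd U T1) (C2 : Crd U T2) : Crd U (T1 * T2) :=
  fun s h => (exists2 f, C1 s f & h = fun t => f t.1) \/
             (exists2 f, C2 s f & h = fun t => f t.2).

Definition fun_crd (I T : Type) (C : Crd U T) : Crd U (I -> T) :=
  fun s h => exists i, exists2 f, C s f & h = fun c => f (c i).

End Definability.

(* Instance search must not unfold these types to products and function spaces, whose coordinates
   are given by other instances. *)
#[global] Hint Opaque asg env : typeclass_instances.
#[export] Existing Instances env_crd asg_crd sort_crd prod_crd fun_crd.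

Section DefinableSets.

Variables (S : Type) (L : language S) (U : structure L).
Implicit Types (X Y Z : seq S).

Definition tuple_at T X (v : forall s, var X s -> T -> U s) (t : T) : env U X :=
  env_tab (fun s x => v s x t).

Lemma lookup_at T X (v : forall s, var X s -> T -> U s) t s (x : var X s) :
  lookup x (tuple_at v t) = v s x t.
Proof. exact: lookup_tab. Qed.

(** Definability in [U] without parameters. A formula reads finitely many coordinates, so a
    definable set of infinite tuples constrains finitely many of them only. *)
Definition Def T {C : Crd U T} (P : T -> Prop) : Prop :=
  exists X (phi : formula L X) (v : forall s, var X s -> T -> U s),
    (forall s x, crd (v s x)) /\ forall t, P t <-> holds phi (tuple_at v t).

Definition cmap T1 T2 {C1 : Crd U T1} {C2 : Crd U T2} (g : T1 -> T2) : Prop :=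
  forall s (f : T2 -> U s), crd f -> crd (fun t => f (g t)).

Lemma Def_ext T {C : Crd U T} (P Q : T -> Prop) :
  (forall t, P t <-> Q t) -> Def P -> Def Q.
Proof.
move=> PQ [X [phi [v [vC H]]]]; exists X, phi, v; split=> // t.
by rewrite -PQ.
Qed.

Lemma Def_comp T1 T2 {C1 : Crd U T1} {C2 : Crd U T2} (g : T1 -> T2)
  (P : T2 -> Prop) : cmap g -> Def P -> Def (fun t => P (g t)).
Proof.
move=> gC [X [phi [v [vC H]]]]; exists X, phi, (fun s x t => v s x (g t)).
by split=> [s x|t]; [exact: gC|exact: H].
Qed.

Lemma Def_False T {C : Crd U T} : Def (fun _ : T => False).
Proof.
exists [::], FBot, (fun s x => match var_nil_case x with end).
by split=> // s x; case: (var_nil_case x).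
Qed.

Lemma Def_imp T {C : Crd U T} (P Q : T -> Prop) :
  Def P -> Def Q -> Def (fun t => P t -> Q t).
Proof.
move=> [X [phi [v [vC H]]]] [Y [psi [w [wC K]]]].
pose vw := env_cat (env_tab (C := fun s => T -> U s) v) (env_tab w).
have E t : tuple_at (fun s (x : var (X ++ Y) s) => lookup x vw) t =
    env_cat (tuple_at v t) (tuple_at w t).
  apply: env_ext; apply: var_cat_case => s x; rewrite lookup_at /vw.
    by rewrite !lookup_catl lookup_at lookup_tab.
  by rewrite !lookup_catr lookup_at lookup_tab.
exists (X ++ Y), (FImp (fren phi (fun s => @vinl S X Y s))
                       (fren psi (fun s => @vinr S X Y s))),
  (fun s x => lookup x vw); split=> [|t].
  apply: var_cat_case => s x; rewrite /vw.
    by rewrite lookup_catl lookup_tab.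
  by rewrite lookup_catr lookup_tab.
by rewrite /= !holds_fren E pull_vinl pull_vinr H K.
Qed.

Lemma Def_not T {C : Crd U T} (P : T -> Prop) : Def P -> Def (fun t => ~ P t).
Proof. by move=> HP; apply: Def_imp => //; exact: Def_False. Qed.

Lemma Def_True T {C : Crd U T} : Def (fun _ : T => True).
Proof. by apply: Def_ext (Def_not Def_False) => t; split=> // _ []. Qed.

Lemma Def_cst T {C : Crd U T} (P : Prop) : Def (fun _ : T => P).
Proof.
have [HP|HP] := pselect P.
  by apply: Def_ext Def_True.
by apply: Def_ext Def_False.
Qed.

Lemma Def_and T {C : Crd U T} (P Q : T -> Prop) :
  Def P -> Def Q -> Def (fun t => P t /\ Q t).
Proof.
move=> HP HQ; apply: Def_ext (Def_not (Def_imp HP (Def_not HQ))) => t.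
split=> [|[Pt Qt]]; last by apply.
by move/not_implyP => [Pt /contrapT Qt].
Qed.

Lemma Def_iff T {C : Crd U T} (P Q : T -> Prop) :
  Def P -> Def Q -> Def (fun t => P t <-> Q t).
Proof. by move=> HP HQ; apply: Def_and; apply: Def_imp. Qed.

Lemma Def_all_lt T {C : Crd U T} n (P : nat -> T -> Prop) :
  (forall i, i < n -> Def (P i)) -> Def (fun t => forall i, i < n -> P i t).
Proof.
elim: n => [|n IH] HP; first by apply: Def_ext Def_True.
apply: Def_ext (Def_and (IH _) (HP n _)) => // [t|i lin].
  split=> [[H Hn] i|H]; last by split=> [i lin|]; apply: H => //; exact: ltnW.
  by rewrite ltnS leq_eqVlt => /predU1P[->//|]; exact: H.
by apply: HP; exact: ltnW.
Qed.

Lemma Def_list T {C : Crd U T} (I : Type) (l : list I) (P : I -> T -> Prop) :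
  (forall i, List.In i l -> Def (P i)) ->
  Def (fun t => forall i, List.In i l -> P i t).
Proof.
elim: l => [|j l IH] HP; first by apply: Def_ext Def_True.
apply: Def_ext (Def_and (HP j _) (IH _)) => //= [t||i li].
- split=> [[Hj H] i [<-//|]|H]; first exact: H.
  by split=> [|i li]; apply: H; [left|right].
- by left.
- by apply: HP; right.
Qed.

Lemma Def_holds X (phi : formula L X) : Def (fun e : env U X => holds phi e).
Proof.
exists X, phi, (fun s x => lookup x); split=> [s x|t]; first by exists x.
by rewrite /tuple_at tab_lookup.
Qed.

(** Each variable of the formula reads either a coordinate of [T], and then becomes a variable of
    [X'], or a coordinate of the tuple [z], and then is identified with the variable of [Z] that it
    reads. *)
Lemma split_tuple T {C : Crd U T} Z X (v : forall s, var X s -> T * env U Z -> U s) :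
  (forall s x, crd (v s x)) ->
  exists X' (v' : forall s, var X' s -> T -> U s)
    (r : forall s, var X s -> var (X' ++ Z) s),
    (forall s x, crd (v' s x)) /\
    forall t z, tuple_at v (t, z) = pull r (env_cat (tuple_at v' t) z).
Proof.
elim: X v => [|s X IH] v vC.
  by exists [::], (fun s x => match var_nil_case x with end),
    (fun s x => match var_nil_case x with end); split=> // s x;
    case: (var_nil_case x).
have [X' [v' [r [v'C H]]]] := IH (fun t x => v t (VS s x)) (fun t x => vC _ _).
have E t z : tuple_at v (t, z) =
    (v s (VZ s X) (t, z), tuple_at (fun t x => v t (VS s x)) (t, z)) by [].
case: (vC s (VZ s X)) => [[f fC Ef]|[_ [z0 ->] Ef]].
- pose w := var_cons_case (P := fun u _ => T -> U u) f v'.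
  exists (s :: X'), w, (@var_cons_case S s X
    (fun u _ => var (s :: (X' ++ Z)) u) (VZ s (X' ++ Z)) (fun u x => VS s (r u x))).
  split=> [|t z]; first by apply: var_cons_case.
  rewrite E Ef H; apply: env_ext; apply: (@var_cons_case S s X) => [|u x] /=.
    by [].
  by rewrite !lookup_tab.
- exists X', v', (@var_cons_case S s X
    (fun u _ => var (X' ++ Z) u) (vinr X' z0) r).
  split=> [//|t z].
  rewrite E Ef H; apply: env_ext; apply: (@var_cons_case S s X) => [|u x].
    by rewrite lookup_pull [RHS]lookup_catr.
  by rewrite [RHS]lookup_pull [LHS]lookup_pull.
Qed.

Lemma Def_split T {C : Crd U T} Z (P : T * env U Z -> Prop) : Def P ->
  exists X (phi : formula L (X ++ Z)) (v : forall s, var X s -> T -> U s),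
    (forall s x, crd (v s x)) /\
    forall t z, P (t, z) <-> holds phi (env_cat (tuple_at v t) z).
Proof.
move=> [X [phi [v [vC H]]]].
have [X' [v' [r [v'C E]]]] := split_tuple vC.
exists X', (fren phi r), v'; split=> // t z.
by rewrite holds_fren -E H.
Qed.

Lemma Def_split_rev T {C : Crd U T} Z (P : T * env U Z -> Prop) : Def P ->
  exists X (phi : formula L (Z ++ X)) (v : forall s, var X s -> T -> U s),
    (forall s x, crd (v s x)) /\
    forall t z, P (t, z) <-> holds phi (env_cat z (tuple_at v t)).
Proof.
move=> /Def_split[X [phi [v [vC H]]]].
have [r Hr] := vswap X Z.
exists X, (fren phi r), v; split=> // t z.
by rewrite holds_fren Hr.
Qed.

Lemma Def_all_env T {C : Crd U T} Z (P : T * env U Z -> Prop) :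
  Def P -> Def (fun t => forall z, P (t, z)).
Proof.
move=> /Def_split_rev[X [phi [v [vC H]]]].
exists X, (FAlls phi), v; split=> // t.
by rewrite holds_FAlls; split=> K z; apply/H.
Qed.

Lemma cmap_id T {C : Crd U T} : cmap (fun t : T => t).
Proof. by []. Qed.

Lemma cmap_comp T1 T2 T3 {C1 : Crd U T1} {C2 : Crd U T2} {C3 : Crd U T3}
  (g : T1 -> T2) (h : T2 -> T3) : cmap g -> cmap h -> cmap (fun t => h (g t)).
Proof. by move=> gC hC s f fC; apply: (gC _ (fun t => f (h t))); exact: hC. Qed.

Lemma cmap_fst T0 T1 T2 {C0 : Crd U T0} {C1 : Crd U T1} {C2 : Crd U T2}
  (g : T0 -> T1 * T2) : cmap g -> cmap (fun t => (g t).1).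
Proof. by move=> gC s f fC; apply: (gC s (fun t => f t.1)); left; exists f. Qed.

Lemma cmap_snd T0 T1 T2 {C0 : Crd U T0} {C1 : Crd U T1} {C2 : Crd U T2}
  (g : T0 -> T1 * T2) : cmap g -> cmap (fun t => (g t).2).
Proof. by move=> gC s f fC; apply: (gC s (fun t => f t.2)); right; exists f. Qed.

Lemma cmap_pair T T1 T2 {C : Crd U T} {C1 : Crd U T1} {C2 : Crd U T2}
  (g : T -> T1) (h : T -> T2) : cmap g -> cmap h -> cmap (fun t => (g t, h t)).
Proof. by move=> gC hC s f [[k kC ->]|[k kC ->]]; [exact: gC|exact: hC]. Qed.

Lemma cmap_app T0 I T {C0 : Crd U T0} {C : Crd U T} (g : T0 -> I -> T) (i : I) :
  cmap g -> cmap (fun t => g t i).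
Proof.
move=> gC s f fC; apply: (gC s (fun c => f (c i))); exists i.
by exists f.
Qed.

Lemma cmap_fun T0 I T {C0 : Crd U T0} {C : Crd U T} (g : T0 -> I -> T) :
  (forall i, cmap (fun t => g t i)) -> cmap g.
Proof. by move=> gC s f [i [k kC ->]]; exact: gC. Qed.

Lemma cmap_sort T {C : Crd U T} s (g : T -> U s) : crd g -> cmap g.
Proof. by move=> gC u f fC; case: u f / fC. Qed.

Lemma crd_sort T {C : Crd U T} s (g : T -> U s) : cmap g -> crd g.
Proof. by move=> gC; apply: (gC s (fun u => u)). Qed.

Lemma cmap_env T {C : Crd U T} X (g : T -> env U X) :
  (forall s (x : var X s), crd (fun t => lookup x (g t))) -> cmap g.
Proof. by move=> gC s f [x ->]; exact: gC. Qed.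

Lemma cmap_asg T {C : Crd U T} V (g : T -> asg U V) :
  (forall s v, crd (fun t => g t s v)) -> cmap g.
Proof. by move=> gC s f [x ->]; exact: gC. Qed.

Lemma cmap_asg_app T {C : Crd U T} V (g : T -> asg U V) s (v : V s) :
  cmap g -> cmap (fun t => g t s v).
Proof. by move=> gC; apply: cmap_sort; apply: (gC s (fun e => e s v)); exists v. Qed.

Lemma cmap_lookup T {C : Crd U T} X (g : T -> env U X) s (x : var X s) :
  cmap g -> cmap (fun t => lookup x (g t)).
Proof. by move=> gC; apply: cmap_sort; apply: (gC s (lookup x)); exists x. Qed.

Lemma cmap_cons T {C : Crd U T} X s (g : T -> U s) (h : T -> env U X) :
  cmap g -> cmap h -> @cmap T (env U (s :: X)) _ _ (fun t => (g t, h t)).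
Proof.
move=> gC hC; apply: cmap_env; apply: (@var_cons_case S s X) => [|u x] /=.
  exact: crd_sort.
by apply: crd_sort; exact: cmap_lookup.
Qed.

Lemma cmap_nil T {C : Crd U T} (g : T -> env U [::]) : cmap g.
Proof. by apply: cmap_env => s x; case: (var_nil_case x). Qed.

Lemma cmap_head T {C : Crd U T} X s (g : T -> env U (s :: X)) :
  cmap g -> cmap (fun t => (g t).1).
Proof. by move=> gC; exact: (cmap_lookup (VZ s X) gC). Qed.

Lemma cmap_tail T {C : Crd U T} X s (g : T -> env U (s :: X)) :
  cmap g -> @cmap T (env U X) _ _ (fun t => (g t).2).
Proof.
move=> gC; apply: cmap_env => u x; apply: crd_sort.
exact: (cmap_lookup (VS s x) gC).
Qed.

Lemma cmap_cat T {C : Crd U T} X Y (g : T -> env U X) (h : T -> env U Y) :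
  cmap g -> cmap h -> cmap (fun t => env_cat (g t) (h t)).
Proof.
move=> gC hC; apply: cmap_env; apply: var_cat_case => s x; apply: crd_sort.
  under eq_fun do rewrite lookup_catl.
  exact: cmap_lookup.
under eq_fun do rewrite lookup_catr.
exact: cmap_lookup.
Qed.

Lemma cmap_env_map T {C : Crd U T} V X (v : env V X) (g : T -> asg U V) :
  cmap g -> cmap (fun t => env_map (g t) v).
Proof.
move=> gC; apply: cmap_env => s x; apply: crd_sort.
under eq_fun do rewrite lookup_map.
exact: cmap_asg_app.
Qed.

Lemma Def_ex_env T {C : Crd U T} Z (P : T * env U Z -> Prop) :
  Def P -> Def (fun t => exists z, P (t, z)).
Proof.
move=> HP; apply: Def_ext (Def_not (Def_all_env (Def_not HP))) => t.
split=> [/existsNP[z /contrapT Pz]|[z Pz] H]; first by exists z.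
exact: (H z).
Qed.

Lemma Def_ex_sort T {C : Crd U T} s (P : T * U s -> Prop) :
  Def P -> Def (fun t => exists z, P (t, z)).
Proof.
move=> HP.
have K : Def (fun p : T * env U [:: s] => P (p.1, p.2.1)).
  apply: (Def_comp (g := fun p : T * env U [:: s] => (p.1, p.2.1))) HP.
  apply: cmap_pair; first exact: cmap_fst.
  by apply: (@cmap_head _ _ [::]); exact: cmap_snd.
apply: Def_ext (Def_ex_env K) => t; split=> [[[z []]] /= Pz|[z Pz]].
  by exists z.
by exists (z, tt).
Qed.

Lemma Def_all_sort T {C : Crd U T} s (P : T * U s -> Prop) :
  Def P -> Def (fun t => forall z, P (t, z)).
Proof.
move=> HP; apply: Def_ext (Def_not (Def_ex_sort (Def_not HP))) => t.
split=> [H z|H [z]//]; apply: contrapT => K; apply: H.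
by exists z.
Qed.

Lemma Def_eq T {C : Crd U T} s (f g : T -> U s) :
  cmap f -> cmap g -> Def (fun t => f t = g t).
Proof.
move=> fC gC.
pose phi : formula L [:: s; s] := FEq (Var L (VZ s [:: s])) (Var L (VS s (VZ s [::]))).
apply: (Def_ext (P := fun t => holds phi ((f t, (g t, tt)) : env U [:: s; s]))) => //.
apply: (Def_comp (g := fun t => ((f t, (g t, tt)) : env U [:: s; s]))).
  by do 2![apply: cmap_cons => //]; exact: cmap_nil.
exact: Def_holds.
Qed.

(** Lets Ramsey's theorem, which colours finite sets, act on any definable property of infinite
    sequences. *)
Lemma Def_support A {C : Crd U A} (P : (nat -> A) -> Prop) : Def P ->
  exists n, forall c c' : nat -> A,
    (forall i, i < n -> c i = c' i) -> P c -> P c'.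
Proof.
move=> [X [phi [v [vC H]]]].
suff [n Hn] : exists n, forall c c' : nat -> A,
    (forall i, i < n -> c i = c' i) -> tuple_at v c = tuple_at v c'.
  by exists n => c c' /Hn E /H; rewrite E => /H.
elim: X v vC {phi H} => [|s X IH] v vC; first by exists 0.
have [n Hn] := IH (fun t x => v t (VS s x)) (fun t x => vC _ _).
have [i [f _ Ef]] := vC s (VZ s X).
exists (maxn n i.+1) => c c' E; congr (_, _).
  by rewrite Ef E // leq_max leqnn orbT.
by apply: Hn => j lt_jn; rewrite E // leq_max lt_jn.
Qed.

End DefinableSets.

#[export] Hint Resolve cmap_id cmap_nil : core.

(** * Compactness *)

Lemma finite_set_list (T : Type) (A : set T) :
  finite_set A -> exists l, forall x, A x -> List.In x l.
Proof.
move=> /(@finite_seqP {classic T})[s ->]; exists s => x /=.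
by elim: s => //= y s IH; rewrite inE => /orP[/eqP ->|/IH]; [left|right].
Qed.

Lemma existT_inj (T : Type) (C : T -> Type) s (a b : C s) :
  existT C s a = existT C s b -> a = b.
Proof.
move=> H; have := projT2_eq H.
by rewrite (Prop_irrelevance (projT1_eq H) erefl).
Qed.

(** Rewriting along an equality of dependent pairs: [Q] has to absorb everything that depends on the
    sort. *)
Lemma existT_transport (T : Type) (C : T -> Type) s t (a : C s) (b : C t)
  (Q : forall s, C s -> Prop) : existT C s a = existT C t b -> Q t b -> Q s a.
Proof.
move=> E Qb; change (Q (projT1 (existT C s a)) (projT2 (existT C s a))).
by rewrite E.
Qed.

Lemma small_inj (kappa T T' : Type) (A : set T) (f : T -> T') :
  (forall x y, A x -> A y -> f x = f y -> x = y) ->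
  small kappa [set: T'] -> small kappa A.
Proof.
move=> f_inj T'small kA; apply: T'small; apply: (card_le_trans kA).
have /card_eqPle[_ H] : f @` A #= A.
  by apply: inj_card_eq => x y /set_mem Ax /set_mem Ay; exact: f_inj.
exact: card_le_trans H (card_leT _).
Qed.

Section Compactness.

Variables (S : Type) (L : language S) (kappa : Type) (U : structure L).
Hypothesis U_sat : saturated kappa U.

Lemma Def_asg (V : S -> Type) (P : asg U V -> Prop) : Def P ->
  exists X (phi : formula L X) (w : env V X),
    forall e, P e <-> holds phi (env_map e w).
Proof.
move=> [X [phi [v [vC H]]]].
exists X, phi, (env_tab (fun s x => projT1 (cid (vC s x)))) => e.
rewrite H; suff -> : tuple_at v e = env_map e (env_tab (fun s x => projT1 (cid (vC s x)))) by [].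
apply: env_ext => s x; rewrite lookup_at lookup_map lookup_tab.
by case: cid => y /= ->.
Qed.

Variables (V : S -> Type) (I : Type) (Sigma : I -> asg U V -> Prop).
Hypothesis V_small : small kappa [set: {s & V s}].
Hypothesis Sigma_Def : forall i, Def (Sigma i).
Hypothesis Sigma_fin :
  forall l : list I, exists e, forall i, List.In i l -> Sigma i e.

Let W s := (V s * U s)%type.

Let sat (l : list I) e := forall i, List.In i l -> Sigma i e.

Let value X (t : env W X) : env U X := env_map (fun s p => p.2) t.
Let eval_at (e : asg U V) X (t : env W X) : env U X :=
  env_map (fun s p => e s p.1) t.

(* [G] is the graph of a partial assignment along which [Sigma] remains
   finitely satisfiable. *)
Let good (G : set {s & W s}) :=
  forall (l : list I) X (phi : formula L X) (t : env W X),
    env_in G t -> holds phi (value t) ->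
    exists e, sat l e /\ holds phi (eval_at e t).

Let good0 : good set0.
Proof.
move=> l [|s X] phi t //= tG; last by case: tG.
by have [e He] := Sigma_fin l; case: t tG => _ H; exists e.
Qed.

Let good_chain (F : set (set {s & W s})) :
  F `<=` good -> total_on F subset -> good (\bigcup_(X in F) X).
Proof.
move=> Fgood Ftot l X phi t tF.
suff [G [Ggood tG]] : exists G, good G /\ env_in G t by exact: Ggood.
suff FX : X <> [::] -> exists G, F G /\ env_in G t.
  (* The chain may be empty; the empty tuple lies in the graph [set0], which is good. *)
  case: X phi t tF FX => [|s X] phi t tF H; first by exists set0.
  by have [//|G [/Fgood Gg Gt]] := H; exists G.
elim: X t tF {phi} => // s X IH [p t] /= [[G FG Gp] tF] _.
case: X IH t tF => [|u X] IH t tF; first by exists G.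
have [//|G' [FG' tG']] := IH t tF.
have mono (G1 G2 : set {s & W s}) : G1 `<=` G2 ->
    forall Y (a : env W Y), env_in G1 a -> env_in G2 a.
  by move=> G12; elim=> //= v Y IHY a [/G12 ? /IHY].
have [GG'|G'G] := Ftot _ _ FG FG'.
- by exists G'; split=> //; split=> //; exact: GG'.
- by exists G; split=> //; split=> //; exact: mono G'G _ _ tG'.
Qed.

(** Two values of one name would make an inequality true that must then be satisfiable with the name
    [v] on both sides. *)
Let good_fun G s (v : V s) (u u' : U s) : good G ->
  G (existT W s (v, u)) -> G (existT W s (v, u')) -> u = u'.
Proof.
move=> Gg Gu Gu'; apply: contrapT => uu'.
have [||e [_]] := Gg [::] [:: s; s]
  (FNot (FEq (Var L (VZ s [:: s])) (Var L (VS s (VZ s [::])))))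
  ((v, u), ((v, u'), tt)) => //=.
Qed.

(** All occurrences of the new point are merged into one variable, so that goodness of the larger
    graph becomes a statement about formulas in one free variable over [G], which is what saturation
    handles. *)
Let split_point G s (p : W s) X (t : env W X) :
  env_in (G `|` [set existT W s p]) t ->
  exists X' (t' : env W X') (r : forall u, var X u -> var (s :: X') u),
    env_in G t' /\ t = pull r ((p, t') : env W (s :: X')).
Proof.
elim: X t => [|u X IH] t.
  by case: t => _; exists [::], tt, (fun s x => match var_nil_case x with end).
case: t => a t /= [aG /IH[X' [t' [r [t'G Et]]]]].
case: aG => [Ga|/= Ea].
- pose k v (y : var (s :: X') v) : var (s :: u :: X') v :=
    var_cons_case (P := fun w _ => var (s :: u :: X') w) (VZ s (u :: X'))
      (fun w z => VS s (VS u z)) y.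
  exists (u :: X'), (a, t'), (@var_cons_case S u X
    (fun w _ => var (s :: u :: X') w) (VS s (VZ u X')) (fun w x => k w (r w x))).
  split=> //; apply: (@env_ext S W (u :: X)); apply: (@var_cons_case S u X) => [|w x] //.
  rewrite lookup_pull /= Et lookup_pull.
  pattern w, (r w x); apply: (@var_cons_case S s X') => [|w' x'] //.
- suff [r0 Hr0] : exists r0 : var (s :: X') u,
      lookup r0 ((p, t') : env W (s :: X')) = a.
    exists X', t', (@var_cons_case S u X (fun w _ => var (s :: X') w) r0 r).
    split=> //; apply: (@env_ext S W (u :: X)); apply: (@var_cons_case S u X) => [|w x] //.
    by rewrite lookup_pull /= Et lookup_pull.
  apply: (existT_transport (Q := fun u a => exists r0 : var (s :: X') u,
      lookup r0 ((p, t') : env W (s :: X')) = a) Ea).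
  by exists (VZ s X').
Qed.

(** Every value has a name, and by [good_fun] a name has only one value, so the values inject into
    the names. *)
Let small_values G : good G ->
  small kappa [set q : {s & U s} | exists v, G (existT W (projT1 q) (v, projT2 q))].
Proof.
move=> Gg; have [[[s0 v0] _]|noV] := pselect (exists v : {s & V s}, True).
- pose f (q : {s & U s}) : {s & V s} :=
    if pselect (exists v, G (existT W (projT1 q) (v, projT2 q))) is left H
    then existT V (projT1 q) (projT1 (cid H)) else existT V s0 v0.
  apply: (small_inj (f := f)) V_small => -[s u] [s' u'] /= K1 K1'.
  rewrite /f; case: pselect => [K|//]; case: pselect => [K'|//] /=.
  case: (cid K) => /= v Gv; case: (cid K') => /= v' Gv' E.
  move: Gv {K K1}; move: u; apply: (existT_transport (Q := fun s v => forall u,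
    G (existT W s (v, u)) -> existT U s u = existT U s' u') E) => u Gv.
  by rewrite (good_fun Gg Gv Gv').
- move=> H; apply: V_small; apply: card_le_trans H _.
  rewrite (_ : mkset _ = set0) ?card_le0x //.
  by apply/seteqP; split=> // -[s u] [v _]; apply: noV; exists (existT V s v).
Qed.

(** The type realized by [u] consists of the formulas that finitely many conditions of [Sigma] force
    on the value of [v]. The negation of a formula true of [u] is therefore not forced, which is
    what goodness asks. *)
Let good_extend G s (v : V s) : good G ->
  exists u, good (G `|` [set existT W s (v, u)]).
Proof.
move=> Gg.
pose forced Y (phi : formula L (s :: Y)) (t : env W Y) l :=
  forall e, sat l e -> holds phi ((e s v, eval_at e t) : env U (s :: Y)).
pose p : set (pformula U s) := [set q | exists t, [/\ env_in G t,
  (projT2 q).2 = value t & exists l, forced (projT1 q) (projT2 q).1 t l]].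
have [q [t [tG -> _]]|p0 p0p p0fin|u Hu] := U_sat (s := s) (p := p) (small_values Gg).
- elim: (projT1 q) t tG => //= u Y IH t [Gt tG]; split; last exact: IH.
  by exists t.1.1; move: Gt; case: t.1.
- have [l0 Hl0] := finite_set_list p0fin.
  suff [Y [phi [t [l [tG [Hf K]]]]]] : exists Y (phi : formula L (s :: Y))
      (t : env W Y) l, env_in G t /\ forced Y phi t l /\
      forall x : U s, holds phi ((x, value t) : env U (s :: Y)) ->
      forall q, List.In q l0 -> p0 q -> pholds q x.
    have [Hx|Hx] := pselect (exists x : U s, holds phi ((x, value t) : env U (s :: Y))).
      by have [x Hx'] := Hx; exists x => q qp0; apply: K => //; exact: Hl0.
    (* If nothing satisfied the forced formula, then by goodness this fact would also hold at some
       assignment satisfying [l], where the value of [v] contradicts it. *)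
    have [|e [He Hphi]] := Gg l _ (FAll (FNot phi)) t tG.
      by move=> x xphi; apply: Hx; exists x.
    by case: (Hphi (e s v)); exact: Hf.
  elim: l0 {Hl0} => [|q l0 [Y [phi [t [l [tG [Hf K]]]]]]].
    exists [::], (FNot FBot), tt, [::]; split=> //; split=> // e _ [].
  have [qp0|qp0] := pselect (p0 q); last first.
    exists Y, phi, t, l; split=> //; split=> // x Hx q' /= [<- //|].
    exact: K.
  have [t' [t'G Et' [l' Hf']]] := p0p _ qp0.
  case: q => Y' [phi' b] /= in qp0 t' t'G Et' Hf' *.
  pose r := rlift (t := s) (fun s => @vinl S Y Y' s).
  pose r' := rlift (t := s) (fun s => @vinr S Y Y' s).
  exists (Y ++ Y'), (FNot (FImp (fren phi r) (FNot (fren phi' r')))),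
    (env_cat t t'), (l ++ l'); split; last split.
  + by elim: Y t tG {phi Hf K r r'} => //= u Y IH t [? ?]; split=> //; exact: IH.
  + move=> e He /=; apply; rewrite holds_fren /eval_at env_map_cat pull_rlift.
      by rewrite pull_vinl; apply: Hf => i il; apply: He; apply: List.in_or_app; left.
    by rewrite pull_vinr; apply: Hf' => i il; apply: He; apply: List.in_or_app; right.
  + move=> x /= /not_implyP[].
    rewrite !holds_fren !pull_rlift /value env_map_cat pull_vinl pull_vinr.
    move=> Hx /contrapT Hx' q' [<- _|]; last exact: K.
    by rewrite /pholds /= Et'.
- exists u => l X phi t /split_point[X' [t' [r [t'G ->]]]].
  rewrite /value /eval_at -!pull_map -!holds_fren /= => Hphi.
  apply: contrapT => K.
  suff : pholds (existT _ X' (FNot (fren phi r), value t')) u by exact.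
  apply: Hu; exists t'; split=> //; exists l => e He /= Hp.
  by apply: K; exists e; split=> //; rewrite -pull_map; apply/holds_fren.
Qed.

(** Saturation realizes types in one variable; Zorn's lemma turns this into an assignment of all
    names at once. The index type [I] may have any size, since saturation bounds only the set of
    parameters. *)
Theorem compactness : exists e, forall i, Sigma i e.
Proof.
have [G [Gg Gmax]] := Zorn_bigcup good_chain.
have tot s (v : V s) : exists u, G (existT W s (v, u)).
  have [u Hu] := good_extend v Gg; exists u.
  apply: contrapT => K; apply: Gmax Hu.
  split; first by left.
  by move=> H; apply: K; apply: H; right.
exists (fun s v => projT1 (cid (tot s v))) => i.
have [X [phi [w H]]] := Def_asg (Sigma_Def i).
apply/H; apply: contrapT => K.
pose t : env W X := env_map (fun s v => (v, projT1 (cid (tot s v)))) w.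
have [||e [He]] := Gg [:: i] _ (FNot phi) t.
- rewrite /t; elim: X w {phi H K t} => //= s X IH w; split; last exact: IH.
  by case: cid.
- by rewrite /= /value /t env_map_comp.
- rewrite /= /eval_at /t env_map_comp; apply; apply/H.
  by apply: He; left.
Qed.

End Compactness.

(** * Ramsey's theorem and shattering *)

Definition inc (g : nat -> nat) : Prop := forall i j, i < j -> g i < g j.

Lemma incS (g : nat -> nat) : (forall i, g i < g i.+1) -> inc g.
Proof.
move=> gS i j; elim: j => // j IH; rewrite ltnS leq_eqVlt => /predU1P[->//|].
by move=> /IH /ltn_trans; apply.
Qed.

Lemma inc_comp (g h : nat -> nat) : inc g -> inc h -> inc (fun i => g (h i)).
Proof. by move=> gI hI i j ij; apply: gI; exact: hI. Qed.

Lemma inc_id : inc (fun i => i). Proof. by []. Qed.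

Lemma inc_S : inc S. Proof. by []. Qed.

Lemma inc_double : inc double. Proof. by move=> i j; rewrite ltn_double. Qed.

Lemma inc_inj (g : nat -> nat) : inc g -> injective g.
Proof.
by move=> gI i j E; case: (ltngtP i j) => // /gI; rewrite E ltnn.
Qed.

Lemma inc_choice (Q : nat -> nat -> Prop) :
  (forall i m, exists j, m <= j /\ Q i j) ->
  exists g, inc g /\ forall i, Q i (g i).
Proof.
move=> H; pose next i m := projT1 (cid (H i m)).
pose g := fix g i := if i is i'.+1 then next i (g i').+1 else next 0 0.
exists g; split; first by apply: incS => i /=; rewrite /next; case: cid => j [].
by case=> [|i] /=; rewrite /next; case: cid => j [].
Qed.

(** An increasing sequence stands for the set of its first [n] terms. The induction fixes the least
    element: the sets [Hs i] are infinite and nested, and the colour of a set with least element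
    [k i] and its other elements in [Hs i.+1] depends on [i] only. *)
Lemma infinite_Ramsey n (P : (nat -> nat) -> Prop) :
  (forall f g, (forall i, i < n -> f i = g i) -> P f -> P g) ->
  exists h, inc h /\ ((forall g, inc g -> P (fun i => h (g i))) \/
                      (forall g, inc g -> ~ P (fun i => h (g i)))).
Proof.
elim: n P => [|n IH] P supp.
  exists id; split; first exact: inc_id.
  have [Pid|Pid] := pselect (P id).
    by left=> g _; apply: supp Pid.
  by right=> g _ Pg; apply: Pid; apply: supp Pg.
pose cons k (f : nat -> nat) i := if i is j.+1 then f j else k.
pose homog k (h : nat -> nat) := (forall g, inc g -> P (cons k (fun i => h (g i)))) \/
                (forall g, inc g -> ~ P (cons k (fun i => h (g i)))).
have step (H : nat -> nat) : exists h, inc h /\ homog (H 0) (fun i => H (h i).+1).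
  have [|h [hI Hh]] := IH (fun f => P (cons (H 0) (fun i => H (f i).+1))).
    move=> f g fg; apply: supp => -[//|i]; rewrite ltnS => lt_in /=.
    by rewrite fg.
  by exists h.
pose ext H := projT1 (cid (step H)).
(* The successor discards the first term of the previous set, which becomes the least element
   [k i]. *)
pose Hs := fix Hs i := if i is i'.+1 then fun j => Hs i' (ext (Hs i') j).+1 else id.
have extI H : inc (ext H) by rewrite /ext; case: cid => h [].
have HsI i : inc (Hs i).
  elim: i => [//|i IHi] /=.
  by apply: (inc_comp IHi); apply: (inc_comp inc_S); exact: extI.
pose k i := Hs i 0.
have homk i : homog (k i) (Hs i.+1).
  by rewrite /k /= /ext; case: cid => h [].
have kI : inc k.
  by apply: incS => i; rewrite /k /=; apply: HsI; exact: ltn0Sn.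
have tail i d : exists h, inc h /\ forall j, Hs (i + d) j = Hs i (h j).
  elim: d => [|d [h [hI Eh]]]; first by exists id; rewrite addn0; split; first exact: inc_id.
  exists (fun j => h (ext (Hs (i + d)) j).+1); split.
    exact: (inc_comp hI (inc_comp inc_S (extI _))).
  by move=> j; rewrite addnS /= Eh.
have ktail i : exists h, inc h /\ forall d, k (i + d).+1 = Hs i.+1 (h d).
  pose h d := projT1 (cid (tail i.+1 d)) 0.
  have Eh d : k (i + d).+1 = Hs i.+1 (h d).
    by have [_ E] := projT2 (cid (tail i.+1 d)); rewrite /k -addSn E.
  exists h; split=> // d d' dd'.
  have : k (i + d).+1 < k (i + d').+1 by apply: kI; rewrite ltnS ltn_add2l.
  rewrite !Eh => lt_H; case: (ltngtP (h d) (h d')) => // [/(HsI i.+1)|E].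
    by move=> /(ltn_trans lt_H); rewrite ltnn.
  by rewrite E ltnn in lt_H.
have homk' i (g : nat -> nat) : inc g -> (forall j, i < g j) ->
    exists g', inc g' /\ (fun j => k (g j)) = (fun j => Hs i.+1 (g' j)).
  move=> gI gi; have [h [hI Eh]] := ktail i.
  have Eg j : g j = (i + (g j - i.+1)).+1 by rewrite -addSn subnKC.
  exists (fun j => h (g j - i.+1)); split.
    apply: (inc_comp hI) => a b ab.
    apply: ltn_sub2r; last exact: gI.
    exact: leq_ltn_trans (gi a) (gI _ _ ab).
  by apply/funext => j; rewrite {1}Eg Eh.
have cons_eta (f : nat -> nat) : P f <-> P (cons (f 0) (fun i => f i.+1)).
  by split; apply: supp; case.
pose yes i := forall g, inc g -> P (cons (k i) (fun j => Hs i.+1 (g j))).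
(* Either infinitely many [k i] have the colour [P], and these form the homogeneous set, or all of
   them have the other colour from some point on. *)
have [inf|fin] := pselect (forall m, exists i, m <= i /\ yes i).
- have [m [mI Hm]] := inc_choice (fun _ => inf).
  exists (fun i => k (m i)); split; first exact: inc_comp.
  left=> g gI; rewrite cons_eta.
  have [||g' [g'I ->]] := homk' (m (g 0)) (fun j => m (g j.+1)).
  + by apply: (inc_comp mI); apply: (inc_comp gI).
  + by move=> j; apply: mI; exact: gI.
  exact: Hm.
- have [m0 Hm0] : exists m0, forall i, m0 <= i -> ~ yes i.
    move/existsNP: fin => [m0 Hm0]; exists m0 => i m0i yi.
    by apply: Hm0; exists i.
  exists (fun i => k (m0 + i)); split.
    by apply: (inc_comp kI) => i j ij; rewrite ltn_add2l.
  right=> g gI; rewrite cons_eta.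
  have [||g' [g'I ->]] := homk' (m0 + g 0) (fun j => m0 + g j.+1).
  + by move=> i j ij; rewrite ltn_add2l; apply: gI.
  + by move=> j; rewrite ltn_add2l; exact: gI.
  case: (homk (m0 + g 0)) => [H|]; last exact.
  by case: (Hm0 (m0 + g 0)) => //; exact: leq_addr.
Qed.

Definition shatters A B (R : A -> B -> Prop) n : Prop :=
  exists a : nat -> A, forall I : set nat, exists b,
    forall i, i < n -> (R (a i) b <-> I i).

Lemma shattersW A B (R : A -> B -> Prop) m n :
  n <= m -> shatters R m -> shatters R n.
Proof.
move=> nm [a H]; exists a => I; have [b Hb] := H I; exists b => i lt_in.
by apply: Hb; exact: leq_trans nm.
Qed.

(** If [2 ^ n] points are shattered, index them by the subsets of [n] and take, for each [k < n], a
    parameter that selects the points whose subset contains [k]. The points then realize all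
    patterns on these parameters. *)
Lemma shatters_dual A B (R : A -> B -> Prop) :
  (forall n, shatters R n) -> forall n, shatters (fun b a => R a b) n.
Proof.
move=> H n; pose T := {ffun 'I_n -> bool}.
have [a Ha] := H #|T|.
pose J k : set nat := [set m | exists (ltm : m < #|T|) (ltk : k < n),
  (enum_val (Ordinal ltm) : T) (Ordinal ltk)].
exists (fun k => projT1 (cid (Ha (J k)))) => I.
pose w : T := [ffun i : 'I_n => `[< I i >]].
exists (a (enum_rank w)) => k ltk; case: cid => b /= ->; last exact: ltn_ord.
have E (ltm : enum_rank w < #|T|) (ltk' : k < n) :
    (enum_val (Ordinal ltm) : T) (Ordinal ltk') = `[< I k >].
  rewrite (_ : Ordinal ltm = enum_rank w); last exact: val_inj.
  by rewrite enum_rankK ffunE.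
split=> [[ltm [ltk' K]]|Ik]; first by move: K; rewrite E => /asboolP.
by exists (ltn_ord _), ltk; rewrite E; apply/asboolP.
Qed.

(** * Shattering of finite sets as a first-order condition *)

Section ShatteringSentence.

Variables (S : Type) (L : language S).
Implicit Types (X Y G : seq S).

(* Unlike [Def], the defining formula does not depend on the structure. *)
Definition udef G (P : forall M : structure L, env M G -> Prop) : Prop :=
  exists phi : formula L G, forall M e, holds phi e <-> P M e.

Lemma udef_ren G H (P : forall M : structure L, env M G -> Prop)
  (r : forall s, var G s -> var H s) :
  udef P -> udef (fun M (e : env M H) => P M (pull r e)).
Proof.
by move=> [p Hp]; exists (fren p r) => M e; rewrite holds_fren Hp.
Qed.

Lemma udef_not G (P : forall M : structure L, env M G -> Prop) :
  udef P -> udef (fun M e => ~ P M e).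
Proof. by move=> [p Hp]; exists (FNot p) => M e /=; rewrite Hp. Qed.

Lemma udef_imp G (P Q : forall M : structure L, env M G -> Prop) :
  udef P -> udef Q -> udef (fun M e => P M e -> Q M e).
Proof. by move=> [p Hp] [q Hq]; exists (FImp p q) => M e /=; rewrite Hp Hq. Qed.

Lemma udef_ext G (P Q : forall M : structure L, env M G -> Prop) :
  (forall M e, P M e <-> Q M e) -> udef P -> udef Q.
Proof. by move=> H [p Hp]; exists p => M e; rewrite Hp. Qed.

Lemma udef_cst G (b : Prop) : udef (fun M (e : env M G) => b).
Proof.
have [Hb|Hb] := pselect b; last by exists FBot.
by exists (FNot FBot) => M e /=; split.
Qed.

Lemma udef_and G (P Q : forall M : structure L, env M G -> Prop) :
  udef P -> udef Q -> udef (fun M e => P M e /\ Q M e).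
Proof.
move=> uP uQ; apply: udef_ext (udef_not (udef_imp uP (udef_not uQ))) => M e.
by split=> [/not_implyP[? /contrapT]|[? ?]]; [split|apply].
Qed.

Lemma udef_all (T : eqType) (l : seq T) G
  (P : T -> forall M : structure L, env M G -> Prop) :
  (forall t, udef (P t)) -> udef (fun M e => forall t, t \in l -> P t M e).
Proof.
move=> uP; elim: l => [|t l IH].
  by apply: udef_ext (@udef_cst G True) => M e; split.
apply: udef_ext (udef_and (uP t) IH) => M e; split=> [[Pt Pl] u|H].
  by rewrite inE => /predU1P[->//|]; exact: Pl.
by split=> [|u ul]; apply: H; rewrite inE ?eqxx ?ul ?orbT.
Qed.

Lemma udef_ex Y G (P : forall M : structure L, env M (Y ++ G) -> Prop) :
  udef P -> udef (fun M e => exists b, P M (env_cat b e)).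
Proof.
move=> [p Hp]; exists (FNot (FAlls (FNot p))) => M e /=; rewrite holds_FAlls.
split=> [/existsNP[b /= /contrapT /Hp]|[b /Hp Pb] H]; first by exists b.
exact: (H b).
Qed.

Variables (X Y : seq S).

Fixpoint copies n : seq S := if n is n'.+1 then X ++ copies n' else [::].

(** Out-of-range indices fall back on copy 0, which exists because there are [n.+1] copies. *)
Fixpoint copy n (i : nat) s (x : var X s) : var (copies n.+1) s :=
  match n return var (copies n.+1) s with
  | 0 => vinl [::] x
  | n'.+1 => if i == n'.+1 then vinl (copies n'.+1) x else vinr X (copy n' i x)
  end.

Fixpoint copies_env (M : structure L) (a : nat -> env M X) n :
    env M (copies n) :=
  match n return env M (copies n) with
  | 0 => tt
  | n'.+1 => env_cat (a n') (copies_env a n')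
  end.

Lemma pull_copy (M : structure L) (a : nat -> env M X) n i : i <= n ->
  pull (fun s => @copy n i s) (copies_env a n.+1) = a i.
Proof.
elim: n => [|n IH] lin.
  by move: lin; rewrite leqn0 => /eqP ->; rewrite /copy pull_vinl.
apply: env_ext => s x; rewrite lookup_pull /=.
have [->|ne] := eqVneq i n.+1; first by rewrite lookup_catl.
rewrite lookup_catr -IH ?lookup_pull //.
by rewrite -ltnS ltn_neqAle ne.
Qed.

(** The same sentence serves all structures, so shattering passes between models of the same
    sentences. It quantifies over [n.+1] points and, for each of the finitely many patterns [w],
    over one parameter. *)
Lemma shatters_sentence (phi : formula L (X ++ Y)) n :
  exists sigma : sentence L, forall M, satisfies M sigma <->
    shatters (fun a b => @holds _ _ M _ phi (env_cat a b)) n.+1.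
Proof.
pose T := {ffun 'I_n.+1 -> bool}.
pose pat (w : T) (M : structure L) (e : env M (copies n.+1)) :=
  exists b : env M Y, forall i : 'I_n.+1, i \in enum 'I_n.+1 ->
    (holds phi (env_cat (pull (fun s => @copy n i s) e) b) <-> w i).
have upat w : udef (@pat w).
  pose r (i : 'I_n.+1) s (z : var (X ++ Y) s) : var (Y ++ copies n.+1) s :=
    lookup z (env_cat (env_tab (C := var (Y ++ copies n.+1))
      (fun s x => vinr Y (@copy n i s x))) (env_tab (@vinl S Y _))).
  have Er (M : structure L) (i : 'I_n.+1) (b : env M Y) (e : env M (copies n.+1)) :
      pull (r i) (env_cat b e) =
      env_cat (pull (fun s => @copy n i s) e) b.
    apply: env_ext; apply: var_cat_case => s z; rewrite lookup_pull /r.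
      rewrite !lookup_catl lookup_tab lookup_pull.
      exact: lookup_catr.
    by rewrite !lookup_catr lookup_tab lookup_catl.
  have : udef (fun (M : structure L) (e : env M (Y ++ copies n.+1)) => forall i : 'I_n.+1,
      i \in enum 'I_n.+1 -> (holds phi (pull (r i) e) <-> w i)).
    apply: udef_all => i; apply: udef_and; apply: udef_imp;
      rewrite /is_true; try exact: udef_cst.
      by apply: (udef_ren (P := fun (M : structure L) (e : env M (X ++ Y)) => holds phi e)); exists phi.
    by apply: (udef_ren (P := fun (M : structure L) (e : env M (X ++ Y)) => holds phi e)); exists phi.
  move=> /udef_ex; apply: udef_ext => M e.
  by split=> -[b Hb]; exists b => i iE; have := Hb i iE; rewrite Er.
have : udef (fun (M : structure L) (e : env M (copies n.+1 ++ [::])) => forall w : T, w \in enum T ->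
    pat w M (pull (fun s => @vinl S (copies n.+1) [::] s) e)).
  by apply: udef_all => w; exact: udef_ren.
move=> /udef_ex[sigma Hs]; exists sigma => M; rewrite /satisfies Hs {Hs sigma}.
split=> [[e He]|[a Ha]].
- have {}He (w : T) : pat w M e.
    by have := He w; rewrite mem_enum pull_vinl; apply.
  exists (fun i => pull (fun s => @copy n i s) e) => I.
  have [b Hb] := He [ffun i : 'I_n.+1 => `[< I i >]].
  exists b => i lin; have := Hb (Ordinal lin) (mem_enum _ _).
  by rewrite ffunE /= => ->; split=> /asboolP.
- exists (copies_env a n.+1) => w _; rewrite pull_vinl.
  have [b Hb] := Ha [set i | exists lin : i < n.+1, w (Ordinal lin)].
  exists b => i _; rewrite pull_copy ?Hb //; last by rewrite -ltnS.
  split=> [[lin]|wi]; first by rewrite (_ : Ordinal lin = i) //; exact: val_inj.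
  by exists (ltn_ord i); rewrite (_ : Ordinal _ = i) //; exact: val_inj.
Qed.

End ShatteringSentence.

Fixpoint vidx (S : Type) (X : seq S) s (x : var X s) : nat :=
  match x with VZ _ _ => 0 | VS _ _ _ y => (vidx y).+1 end.

Lemma vidx_inj (S : Type) (X : seq S) s t (x : var X s) (y : var X t) :
  vidx x = vidx y -> existT (var X) s x = existT (var X) t y.
Proof.
elim: X s t x y => [|u X IH] s t x y; first by case: (var_nil_case x).
move: s x t y; apply: (@var_cons_case S u X) => [|s x];
  apply: (@var_cons_case S u X) => [|t y] //= [/IH E].
by apply: (existT_transport (Q := fun s x =>
  existT (var (u :: X)) s (VS u x) = existT (var (u :: X)) t (VS u y)) E).
Qed.

(** * Codes for names, and spaces covered by assignments *)

Section Coding.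

Variables (S : Type) (L : language S).

Let Fimp_l X (phi : formula L X) :=
  match phi in formula _ X return formula L X with
  | FImp _ p _ => p | FEq _ _ _ _ | FRel _ _ _ | FBot _ | FAll _ _ _ => FBot end.

Let Fimp_r X (phi : formula L X) :=
  match phi in formula _ X return formula L X with
  | FImp _ _ q => q | FEq _ _ _ _ | FRel _ _ _ | FBot _ | FAll _ _ _ => FBot end.

Lemma FImp_inj X (p q p' q' : formula L X) :
  FImp p q = FImp p' q' -> p = p' /\ q = q'.
Proof. by move=> E; split; [move/(congr1 (@Fimp_l X)): E|move/(congr1 (@Fimp_r X)): E]. Qed.

(* Sentences serve as codes: [FImp] pairs them, which avoids any cardinal
   arithmetic. *)
Definition codable (T : Type) := exists f : T -> sentence L, injective f.

Lemma codable_inj T T' (f : T -> T') : injective f -> codable T' -> codable T.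
Proof. by move=> fI [g gI]; exists (g \o f); exact: inj_comp. Qed.

Fixpoint code_nat n : sentence L :=
  if n is n'.+1 then FImp FBot (code_nat n') else FBot.

Lemma codable_nat : codable nat.
Proof. by exists code_nat; elim=> [|n IH] [|m] //= /FImp_inj[_ /IH ->]. Qed.

Lemma codable_prod T T' : codable T -> codable T' -> codable (T * T').
Proof.
move=> [f fI] [g gI]; exists (fun p => FImp (f p.1) (g p.2)).
by move=> [x y] [x' y'] /= /FImp_inj[/fI -> /gI ->].
Qed.

Lemma codable_sum T T' : codable T -> codable T' -> codable (T + T').
Proof.
move=> [f fI] [g gI].
exists (fun p => match p with inl x => FImp FBot (f x)
                            | inr y => FImp (FNot FBot) (g y) end).
by move=> [x|x] [y|y] /FImp_inj[E]// => [/fI ->|/gI ->].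
Qed.

Fixpoint closure X : formula L X -> sentence L :=
  match X return formula L X -> sentence L with
  | [::] => fun p => p
  | _ :: _ => fun p => closure (FAll p)
  end.

Fixpoint strip X (p : formula L X) : {Y & formula L Y} :=
  match p with
  | FAll _ _ q => strip q
  | FImp Y q _ => existT _ Y q
  | FEq _ _ _ _ | FRel _ _ _ | FBot _ => existT _ [::] FBot
  end.

Lemma strip_closure X (p : formula L X) : strip (closure p) = strip p.
Proof. by elim: X p => //= s X IH p; rewrite IH. Qed.

(** The negation marks where the quantifiers added by [closure] end: [strip] removes leading
    quantifiers and stops at the first implication, whose premise is the coded formula with its
    context. *)
Lemma codable_formula : codable {X & formula L X}.
Proof.
exists (fun p => closure (FNot (projT2 p))) => -[X p] [Y q] /= E.
by have := congr1 (@strip [::]) E; rewrite !strip_closure.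
Qed.

Lemma codable_var (X : seq S) : codable {s & var X s}.
Proof.
apply: (codable_inj (f := fun p => vidx (projT2 p))) codable_nat.
by move=> [s x] [t y] /= E; exact: vidx_inj.
Qed.

Lemma codable_sum_fam (V V' : S -> Type) : codable {s & V s} ->
  codable {s & V' s} -> codable {s & V s + V' s}%type.
Proof.
move=> cV cV'; apply: (codable_inj (f := fun p => match projT2 p with
    | inl v => inl (existT V (projT1 p) v)
    | inr v => inr (existT V' (projT1 p) v) end)) (codable_sum cV cV').
move=> [s [v|v]] [t [w|w]] //= [_ E].
  by apply: (existT_transport (Q := fun s v =>
    existT (fun s => V s + V' s)%type s (inl v) =
    existT (fun s => V s + V' s)%type t (inl w)) E).
by apply: (existT_transport (Q := fun s v =>
    existT (fun s => V s + V' s)%type s (inr v) =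
    existT (fun s => V s + V' s)%type t (inr w)) E).
Qed.

Lemma codable_prod_fam (T : Type) (V : S -> Type) : codable T ->
  codable {s & V s} -> codable {s & T * V s}%type.
Proof.
move=> cT cV; apply: (codable_inj (f := fun p =>
  ((projT2 p).1, existT V (projT1 p) (projT2 p).2))) (codable_prod cT cV).
move=> [s [x v]] [t [y w]] //= [-> _ E].
by apply: (existT_transport (Q := fun s v =>
  existT (fun s => T * V s)%type s (y, v) = existT (fun s => T * V s)%type t (y, w)) E).
Qed.

Variable U : structure L.

(** Compactness is proved for assignments; it transfers to the images of spaces of assignments with
    few names under maps that respect coordinates. *)
Definition presentable T {C : Crd U T} : Prop :=
  exists V : S -> Type, codable {s & V s} /\
  exists g : asg U V -> T, cmap g /\ forall t, exists e, g e = t.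

Lemma presentable_asg V : codable {s & V s} -> presentable (T := asg U V).
Proof. by move=> cV; exists V; split=> //; exists id; split=> // t; exists t. Qed.

Lemma presentable_env X : presentable (T := env U X).
Proof.
exists (var X); split; first exact: codable_var.
exists (fun e => env_tab e); split=> [|t].
  apply: cmap_env => s x; under eq_fun do rewrite lookup_tab.
  by exists x.
by exists (fun s x => lookup x t); rewrite tab_lookup.
Qed.

Lemma presentable_prod T T' {C : Crd U T} {C' : Crd U T'} :
  presentable (T := T) -> presentable (T := T') -> presentable (T := (T * T')%type).
Proof.
move=> [V [cV [g [gC gS]]]] [V' [cV' [g' [g'C g'S]]]].
exists (fun s => V s + V' s)%type; split; first exact: codable_sum_fam.
exists (fun e => (g (fun s v => e s (inl v)), g' (fun s v => e s (inr v)))).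
split=> [|[t t']].
  apply: cmap_pair.
    apply: (cmap_comp (T2 := asg U V) (g := fun e s v => e s (inl v)) (h := g)) => //.
    by apply: cmap_asg => s v; exists (inl v).
  apply: (cmap_comp (T2 := asg U V') (g := fun e s v => e s (inr v)) (h := g')) => //.
  by apply: cmap_asg => s v; exists (inr v).
have [e <-] := gS t; have [e' <-] := g'S t'.
by exists (fun s p => match p with inl v => e s v | inr v => e' s v end).
Qed.

Lemma presentable_seq T {C : Crd U T} :
  presentable (T := T) -> presentable (T := nat -> T).
Proof.
move=> [V [cV [g [gC gS]]]].
exists (fun s => nat * V s)%type; split.
  by apply: codable_prod_fam => //; exact: codable_nat.
exists (fun e i => g (fun s v => e s (i, v))); split=> [|t].
  apply: cmap_fun => i.
  apply: (cmap_comp (T2 := asg U V) (g := fun e s v => e s (i, v)) (h := g)) => //.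
  by apply: cmap_asg => s v; exists (i, v).
exists (fun s p => projT1 (cid (gS (t p.1))) s p.2).
by apply/funext => i; case: (cid (gS (t i))).
Qed.

End Coding.

(** * Compactness in the monster model *)

Section Saturated.

Variables (S : Type) (L : language S) (kappa : Type) (U : structure L).
Hypothesis F_small : small kappa [set: {X : seq S & formula L X}].
Hypothesis kappa_lim : strong_limit kappa.
Hypothesis U_sat : saturated kappa U.

Lemma small_codable T : codable L T -> small kappa [set: T].
Proof.
move=> [f fI]; apply: (small_inj (f := fun x => existT (formula L) [::] (f x))) F_small.
by move=> x y _ _ E; exact: fI (existT_inj E).
Qed.

(** Formulas are infinite in number and form a small set, so the natural numbers are small; the
    strong limit hypothesis passes this on to their power set. *)
Lemma small_set_nat : small kappa [set: set nat].
Proof.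
have kappa_inf : infinite_set [set: kappa].
  move=> /finite_set_countable kN; apply: (small_codable (codable_nat L)).
  exact: kN.
have [f fI] : exists f : nat -> kappa, injective f.
  have /infiniteP /card_leP[f] := kappa_inf.
  pose to (n : nat) : [set: nat] := SigSub (mem_set (I : [set: nat] n)).
  exists (fun n => \val (f (to n))) => i j /val_inj E.
  have /(congr1 (fun x => \val x)) : to i = to j by apply: inj E; rewrite in_setT.
  by [].
have : small kappa (range f).
  apply: (small_inj (f := fun x => if pselect (exists n, f n = x) is left H
                                   then projT1 (cid H) else 0))
    (small_codable (codable_nat L)).
  move=> _ _ [m _ <-] [n _ <-].
  case: pselect => [H|[]]; last by exists m.
  case: pselect => [H'|[]]; last by exists n.
  by case: cid => m' /= <-; case: cid => n' /= <- ->.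
move=> /kappa_lim rf kN; apply: rf; apply: (card_le_trans kN).
have /card_eqPle[_ H] : (fun A => f @` A) @` [set: set nat] #= [set: set nat].
  have sub (A B : set nat) : f @` A = f @` B -> A `<=` B.
    move=> E n An; have : (f @` B) (f n) by rewrite -E; exists n.
    by move=> [m Bm /fI <-].
  by apply: inj_card_eq => A B _ _ E; apply/seteqP; split; apply: sub.
apply: card_le_trans H _; apply: subset_card_le.
by move=> _ [A _ <-] _ [n _ <-]; exists n.
Qed.

Theorem compactness_presentable T {C : Crd U T} (I : Type)
  (Sigma : I -> T -> Prop) :
  presentable (T := T) -> (forall i, Def (Sigma i)) ->
  (forall l : list I, exists t, forall i, List.In i l -> Sigma i t) ->
  exists t, forall i, Sigma i t.
Proof.
move=> [V [cV [g [gC gS]]]] SD Sfin.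
have [||l|e He] := compactness U_sat (V := V) (Sigma := fun i e => Sigma i (g e)).
- exact: small_codable.
- by move=> i; exact: Def_comp.
- by have [t Ht] := Sfin l; have [e Ee] := gS t; exists e; rewrite Ee.
- by exists (g e).
Qed.

(** [NIP_formula] speaks of parameters indexed by all sets of natural numbers, so compactness is
    applied with continuum many names. This is where [kappa] has to be a strong limit. *)
Lemma shatters_infinite X Y (phi : formula L (X ++ Y)) :
  (forall n, shatters (fun a b => @holds _ _ U _ phi (env_cat a b)) n) ->
  exists (a : nat -> env U X) (b : set nat -> env U Y),
    forall i I, holds phi (env_cat (a i) (b I)) <-> I i.
Proof.
(* One family of names for both kinds of tuples: a singleton with a variable of [X] names a point,
   any set with a variable of [Y] names a parameter. *)
move=> Sh; pose V s := (set nat * var (X ++ Y) s)%type.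
pose pt (e : asg U V) i : env U X := env_tab (fun s x => e s ([set i], vinl Y x)).
pose par (e : asg U V) I : env U Y := env_tab (fun s y => e s (I, vinr X y)).
have V_small : small kappa [set: {s & V s}].
  (* A name is coded by one set of numbers: its even elements carry the set, its single odd element
     carries the index of the variable. *)
  apply: (small_inj (f := fun p : {s & V s} =>
    [set m | (exists2 j, (projT2 p).1 j & m = j.*2) \/
             m = (vidx (projT2 p).2).*2.+1])) small_set_nat.
  have odd_ne j k : j.*2 <> k.*2.+1.
    by move=> E; have := congr1 odd E; rewrite /= !odd_double.
  move=> [s [I x]] [t [J y]] _ _ /= E.
  have {}E m := congr1 (fun A : set nat => A m) E.
  have : vidx x = vidx y.
    have : [set m | (exists2 j, I j & m = j.*2) \/ m = (vidx x).*2.+1] (vidx x).*2.+1.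
      by right.
    rewrite E /= => -[[j _ /esym/odd_ne//]|[]].
    exact: double_inj.
  move=> Exy0; have Exy := vidx_inj Exy0; suff -> : I = J.
    by apply: (existT_transport (Q := fun s x => existT V s (J, x) = existT V t (J, y)) Exy).
  apply/seteqP; split=> j Ij.
    have : [set m | (exists2 j, I j & m = j.*2) \/ m = (vidx x).*2.+1] j.*2.
      by left; exists j.
    by rewrite E => -[[k Jk /double_inj ->]|/odd_ne].
  have : [set m | (exists2 j, J j & m = j.*2) \/ m = (vidx y).*2.+1] j.*2.
    by left; exists j.
  by rewrite -E => -[[k Jk /double_inj ->]|/odd_ne].
have [||l|e He] := compactness U_sat (V := V) (I := nat * set nat)
    (Sigma := fun p e => holds phi (env_cat (pt e p.1) (par e p.2)) <-> p.2 p.1) => //.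
- move=> [i I]; apply: Def_iff; last exact: Def_cst.
  apply: (Def_comp (P := fun a => holds phi a)
    (g := fun e => env_cat (pt e i) (par e I))) (Def_holds _ phi).
  apply: cmap_cat; apply: cmap_env => s x; under eq_fun do rewrite lookup_tab.
    by exists ([set i], vinl Y x).
  by exists (I, vinr X x).
- have [n Hn] : exists n, forall p, List.In p l -> p.1 < n.
    elim: l => [|p l [n Hn]]; first by exists 0.
    exists (maxn n p.1.+1) => q /= [<-|/Hn qn]; rewrite leq_max ?leqnn ?orbT //.
    by rewrite qn.
  have [a Ha] := Sh n.
  pose b I := projT1 (cid (Ha I)).
  (* [xget] recovers the index of a point from the singleton that names it. *)
  pose e : asg U V := fun s p => lookup p.2 (env_cat (a (xget 0 p.1)) (b p.1)).
  exists e => -[i I] /Hn /= lt_in.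
  have -> : pt e i = a i.
    apply: env_ext => s x; rewrite lookup_tab /e lookup_catl.
    by have -> : xget 0 [set i] = i by apply: (@xgetI _ 0 [set i] i).
  have -> : par e I = b I.
    by apply: env_ext => s x; rewrite lookup_tab /e lookup_catr.
  by rewrite /b; case: cid => /= c Hc; exact: Hc.
- by exists (pt e), (par e) => i I; exact: (He (i, I)).
Qed.

End Saturated.

(** * Indiscernible sequences *)

Section Indiscernibles.

Variables (S : Type) (L : language S) (kappa : Type) (U : structure L).
Hypothesis F_small : small kappa [set: {X : seq S & formula L X}].
Hypothesis kappa_lim : strong_limit kappa.
Hypothesis U_sat : saturated kappa U.

(* Since [P] depends on finitely many terms only, this is the usual notion of
   an indiscernible sequence of tuples. *)
Definition indisc A {C : Crd U A} (c : nat -> A) : Prop :=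
  forall P : (nat -> A) -> Prop, Def P ->
  forall g, inc g -> (P c <-> P (fun i => c (g i))).

Lemma indisc_eq A {C : Crd U A} (c : nat -> A) g h (P : (nat -> A) -> Prop) :
  indisc c -> Def P -> inc g -> inc h ->
  P (fun i => c (g i)) -> P (fun i => c (h i)).
Proof. by move=> ci HP gI hI; rewrite -(ci P HP g gI) -(ci P HP h hI). Qed.

(** Finitely many instances of indiscernibility hold on a subsequence of [c] by Ramsey's theorem,
    and [Q n] then holds on a further one by hypothesis; compactness does the rest. Indiscernibility
    is over the empty set and does not involve [b]. *)
Lemma indisc_extract A B {CA : Crd U A} {CB : Crd U B} (c : nat -> A)
  (Q : nat -> B * (nat -> A) -> Prop) :
  presentable (T := A) -> presentable (T := B) ->
  (forall n, Def (Q n)) -> (forall m n t, m <= n -> Q n t -> Q m t) ->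
  (forall n h, inc h ->
     exists g, inc g /\ exists b, Q n (b, fun i => c (h (g i)))) ->
  exists b c', indisc c' /\ forall n, Q n (b, c').
Proof.
move=> pA pB QD Qmono HQ.
pose I := (nat + {Pg : ((nat -> A) -> Prop) * (nat -> nat) |
                  Def (C := fun_crd CA) Pg.1 /\ inc Pg.2})%type.
pose Sigma (i : I) (t : B * (nat -> A)) := match i with
  | inl n => Q n t
  | inr Pg => (sval Pg).1 t.2 <-> (sval Pg).1 (fun i => t.2 ((sval Pg).2 i))
  end.
have [|i|l|[b c'] H] := compactness_presentable F_small U_sat (Sigma := Sigma).
- by apply: presentable_prod => //; exact: presentable_seq.
- case: i => [n|[[P g] [PD gI]]] //=; first exact: QD.
  apply: Def_iff.
    by apply: (Def_comp (P := P)) PD; exact: cmap_snd.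
  apply: (Def_comp (P := P) (g := fun t i => t.2 (g i))) PD.
  by apply: cmap_fun => i; apply: cmap_app; exact: cmap_snd.
- suff [n [h [hI K]]] : exists n h, inc h /\ forall i, List.In i l ->
      match i return Prop with
      | inl m => m <= n
      | inr Pg =>
          (forall g, inc g -> (sval Pg).1 (fun i => c (h (g i)))) \/
          (forall g, inc g -> ~ (sval Pg).1 (fun i => c (h (g i))))
      end.
    have [g [gI [b Qb]]] := HQ n h hI.
    exists (b, fun i => c (h (g i))) => i /K; case: i => [m mn|[[P g'] [PD g'I]]] /=.
      exact: Qmono Qb.
    have gg'I := inc_comp gI g'I; move=> [] Hg; split=> [HP|HP].
    + exact: (Hg _ gg'I).
    + exact: (Hg _ gI).
    + by case: (Hg _ gI).
    + by case: (Hg _ gg'I).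
  elim: l => [|i l [n [h [hI K]]]]; first by exists 0, id; split; first exact: inc_id.
  case: i => [m|[[P g] [PD gI]]].
    exists (maxn n m), h; split=> // i /= [<-|/K]; first exact: leq_maxr.
    by case: i => // m' /leq_trans; apply; exact: leq_maxl.
  have [N HN] := Def_support PD.
  have [|h' [h'I Hh']] := infinite_Ramsey (n := N) (P := fun f => P (fun i => c (h (f i)))).
    by move=> f f' ff'; apply: HN => i /ff' ->.
  exists n, (fun i => h (h' i)); split; first exact: inc_comp.
  move=> i /= [<-//|/K]; case: i => // -[[P' g'] [P'D g'I]] /= [] H.
    by left=> f fI; apply: (H _ (inc_comp h'I fI)).
  by right=> f fI; apply: (H _ (inc_comp h'I fI)).
- exists b, c'; split=> [P PD g gI|n]; last exact: (H (inl n)).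
  exact: (H (inr (exist _ (P, g) (conj PD gI)))).
Qed.

(** Subsequences of an independent sequence are independent, so along each of them some parameter
    alternates. *)
Lemma shatters_indisc A B {CA : Crd U A} {CB : Crd U B} (R : A * B -> Prop)
  (a : nat -> A) (b : set nat -> B) :
  presentable (T := A) -> presentable (T := B) -> Def R ->
  (forall i I, R (a i, b I) <-> I i) ->
  exists b c, indisc c /\ forall i, R (c i, b) <-> ~~ odd i.
Proof.
move=> pA pB RD H.
have [n|m n [b0 c0] mn K i im|n h hI|b0 [c0 [ci K]]] := indisc_extract
  (Q := fun n t => forall i, i < n -> (R (t.2 i, t.1) <-> ~~ odd i)) (c := a) pA pB.
- apply: Def_all_lt => i _; apply: Def_iff; last exact: Def_cst.
  apply: (Def_comp (P := R) (g := fun t => (t.2 i, t.1))) RD.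
  by apply: cmap_pair; [apply: cmap_app; exact: cmap_snd|exact: cmap_fst].
- by apply: K; exact: leq_trans mn.
- exists id; split; first exact: inc_id.
  exists (b [set h i | i in [set i | ~~ odd i]]) => i _ /=; rewrite H.
  by split=> [[j oj /(inc_inj hI) <-]|oi] //; exists i.
- by exists b0, c0; split=> // i; exact: (K i.+1 i (ltnSn i)).
Qed.

(** To realize [I], choose from the k-th pair of consecutive places of [g] the one with the right
    parity. Indiscernibility moves the existence of the parameter back to the first terms of [c]. *)
Lemma indisc_shatters A Z {C : Crd U A} (R : A * env U Z -> Prop) (c : nat -> A) a g :
  Def R -> indisc c -> inc g -> (forall i, R (c (g i), a) <-> ~~ odd i) ->
  forall n, shatters (fun x y => R (x, y)) n.
Proof.
move=> RD ci gI H n; exists c => I.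
pose P (y : nat -> A) := exists b, forall k, k < n -> (R (y k, b) <-> I k).
have PD : Def P.
  apply: (Def_ex_env (P := fun t => forall k, k < n -> (R (t.1 k, t.2) <-> I k))).
  apply: Def_all_lt => k _; apply: Def_iff; last exact: Def_cst.
  apply: (Def_comp (P := R) (g := fun t => (t.1 k, t.2))) RD.
  by apply: cmap_pair; [apply: cmap_app; exact: cmap_fst|exact: cmap_snd].
pose p k := g (k.*2 + ~~ `[< I k >]).
have pI : inc p.
  apply: incS => k; apply: gI; rewrite doubleS -addn2.
  apply: (@leq_trans (k.*2 + 2)); last exact: leq_addr.
  by rewrite ltn_add2l; case: `[< I k >].
apply/(ci P PD p pI); exists a => k _; rewrite /p H oddD odd_double /=.
by rewrite oddb negbK; split=> /asboolP.
Qed.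

(** [T] is allowed to be a space of infinite tuples; [exchange] applies the condition to pairs of
    sequences. *)
Definition NIP_context Z : Prop :=
  forall T (C : Crd U T) (R : T * env U Z -> Prop), Def R ->
  exists n, ~ shatters (fun x y => R (x, y)) n.

Definition interleaved (e o : nat -> nat) : Prop :=
  forall j, e j < o j /\ o j < e j.+1.

(* The even terms of [c] may carry extra data [w e]. Moving the terms [o] from
   odd to even places could only fail in infinitely many blocks at once, and
   then the resulting alternation would be shattered by [w e]. *)
Lemma exchange A Z {C : Crd U A} (R : ((nat -> A) * (nat -> A)) * env U Z -> Prop)
  (c : nat -> A) (w : (nat -> nat) -> env U Z) h :
  NIP_context Z -> Def R -> indisc c -> inc h ->
  (forall e o, interleaved e o ->
     R ((fun j => c (e j).*2, fun j => c (o j).*2.+1), w e)) ->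
  exists g, inc g /\
    R ((fun j => c (h (g j.*2)).*2, fun j => c (h (g j.*2.+1)).*2),
       w (fun j => h (g j.*2))).
Proof.
move=> nZ RD ci hI HR; apply: contrapT => nog.
have [n] := nZ _ _ _ RD; apply.
(* The sequence is cut into blocks of length [n.+1]. The k-th point consists of the first terms of
   all blocks and their terms at position [k.+1]; the points share the first half. *)
pose blk (y : nat -> A) k := (fun j => y (j * n.+1), fun j => y (j * n.+1 + k.+1)).
exists (fun k => blk (fun m => c (h m).*2) k) => I.
pose P (y : nat -> A) := exists v, forall k, k < n -> (R (blk y k, v) <-> I k).
have PD : Def P.
  apply: (Def_ex_env (P := fun t => forall k, k < n -> (R (blk t.1 k, t.2) <-> I k))).
  apply: Def_all_lt => k _; apply: Def_iff; last exact: Def_cst.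
  apply: (Def_comp (P := R) (g := fun t => (blk t.1 k, t.2))) RD.
  apply: cmap_pair; last exact: cmap_snd.
  by apply: cmap_pair; apply: cmap_fun => i; apply: cmap_app; exact: cmap_fst.
(* In each block the positions [k.+1] with [k] in [I] move from an even place to the odd place next
   to it. The order is kept, so indiscernibility allows this. *)
pose p m := (h m).*2 + [&& m %% n.+1 != 0 & `[< I (m %% n.+1).-1 >]].
have pI : inc p.
  apply: incS => m; apply: (@leq_trans (h m.+1).*2); last exact: leq_addr.
  apply: (@leq_trans (h m).+1.*2); last by rewrite leq_double; exact: hI.
  by rewrite doubleS -addn2 ltn_add2l; case: (X in nat_of_bool X).
apply: (indisc_eq (h := fun m => (h m).*2) ci PD pI).
  by apply: (inc_comp inc_double hI).
pose e j := h (j * n.+1); exists (w e) => k kn.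
have pe j : p (j * n.+1) = (e j).*2 by rewrite /p modnMl addn0.
pose o j := h (j * n.+1 + k.+1).
have po j : p (j * n.+1 + k.+1) = (o j).*2 + `[< I k >].
  by rewrite /p modnMDl modn_small.
have -> : blk (fun m => c (p m)) k =
    (fun j => c (e j).*2, fun j => c ((o j).*2 + `[< I k >])).
  by congr (_, _); apply/funext => j; rewrite ?pe ?po.
(* For [k] in [I] the second half lies at odd places, where the hypothesis applies. Otherwise all
   places are even, and the assumption that no suitable [g] exists makes [R] fail. *)
case: (pselect (I k)) => Ik.
- rewrite (asboolT Ik) /=; split=> // _.
  have -> : (fun j => c ((o j).*2 + 1)) = (fun j => c (o j).*2.+1).
    by apply/funext => j; rewrite addn1.
  apply: HR => j; split; apply: hI; first by rewrite -[X in X < _]addn0 ltn_add2l.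
  by rewrite mulSn addnC ltn_add2r.
- rewrite (asboolF Ik) /=; split=> // K; exfalso; apply: nog.
  pose g m := m./2 * n.+1 + (if odd m then k.+1 else 0).
  have Ee j : h (g j.*2) = e j by rewrite /g odd_double doubleK addn0.
  have Eo j : h (g j.*2.+1) = o j by rewrite /g /= odd_double uphalf_double.
  exists g; split.
    apply: incS => m; rewrite /g /= uphalf_half; case: (odd m) => /=.
      by rewrite add1n addn0 mulSn addnC ltn_add2r.
    by rewrite add0n addn0 -[X in X < _]addn0 ltn_add2l.
  have -> : (fun j => h (g j.*2)) = e by apply/funext.
  have -> : (fun j => c (h (g j.*2)).*2) = (fun j => c (e j).*2).
    by apply/funext => j; rewrite Ee.
  have -> // : (fun j => c (h (g j.*2.+1)).*2) = (fun j => c ((o j).*2 + 0)).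
  by apply/funext => j; rewrite Eo addn0.
Qed.

(** There is only one empty tuple, so not even a single point is shattered. *)
Lemma NIP_context_nil : NIP_context [::].
Proof.
move=> T C R _; exists 1 => -[a H].
have [[] H0] := H set0; have [[] H1] := H setT.
by case: (H0 0 isT) => + _; apply; apply/H1.
Qed.

(** The part [a1] of an alternating parameter is attached to the terms of the sequence. [exchange],
    with [a1] as constant data, keeps an alternation with a new second part, so the relation between
    the extended terms and [X2] is not NIP. *)
Lemma NIP_context_cat X1 X2 :
  NIP_context X1 -> NIP_context X2 -> NIP_context (X1 ++ X2).
Proof.
move=> n1 n2 T C R /Def_split[X [phi [v [_ Hphi]]]].
apply: contrapT => /forallNP Sh.
have [|a [b Hab]] := shatters_infinite F_small kappa_lim U_sat (phi := phi).
  move=> n; have /contrapT[a Ha] := Sh n.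
  exists (fun i => tuple_at v (a i)) => I; have [b Hb] := Ha I.
  by exists b => i lt_in; rewrite -Hb // Hphi.
pose R0 (y : env U X) (x : env U X1) (z : env U X2) := holds phi (env_cat y (env_cat x z)).
have R0D D (CD : Crd U D) (f : D -> env U X) (g : D -> env U X1) (k : D -> env U X2) :
    cmap f -> cmap g -> cmap k -> Def (fun t => R0 (f t) (g t) (k t)).
  move=> fC gC kC; apply: (Def_comp (P := fun t => holds phi t)
    (g := fun t => env_cat (f t) (env_cat (g t) (k t)))) (Def_holds _ phi).
  by do !apply: cmap_cat.
have [|b0 [c [ci Hc]]] := shatters_indisc (presentable_env U X)
    (presentable_env U (X1 ++ X2)) (R := fun p => holds phi (env_cat p.1 p.2)) _ Hab.
  apply: (Def_comp (P := fun t => holds phi t)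
    (g := fun p => env_cat p.1 p.2)) (Def_holds _ phi).
  by apply: cmap_cat; [exact: cmap_fst|exact: cmap_snd].
rewrite -(env_cat_pull b0) in Hc.
set a1 := pull _ _ in Hc; set a2 := pull _ _ in Hc.
pose R1 (p : (env U X * env U X1) * env U X2) := R0 p.1.1 p.1.2 p.2.
have R1D : Def R1.
  apply: R0D; last exact: cmap_snd.
    by apply: cmap_fst; exact: cmap_fst.
  by apply: cmap_snd; exact: cmap_fst.
(* Only the even terms of [c] are kept, paired with [a1]; [exchange] lets some of them play the role
   of odd terms. *)
have [||n|m n [x y] mn K i im|n h hI|b' [c' [c'i Hc']]] := indisc_extract
  (Q := fun n t => forall i, i < n -> (R1 (t.2 i, t.1) <-> ~~ odd i))
  (c := fun i => (c i.*2, a1)).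
- exact: presentable_prod (presentable_env U X) (presentable_env U X1).
- exact: presentable_env.
- apply: Def_all_lt => i _; apply: Def_iff; last exact: Def_cst.
  apply: (Def_comp (P := R1) (g := fun t => (t.2 i, t.1))) R1D.
  by apply: cmap_pair; [apply: cmap_app; exact: cmap_snd|exact: cmap_fst].
- by apply: K; exact: leq_trans mn.
- have [|e o eo|g [gI [x Hx]]] := exchange (c := c) (w := fun _ => a1) (h := h)
      (R := fun t => exists x, forall j, j < n ->
        R0 (t.1.1 j) t.2 x /\ ~ R0 (t.1.2 j) t.2 x) n1 _ ci hI.
  + apply: (Def_ex_env (P := fun t => forall j, j < n ->
        R0 (t.1.1.1 j) t.1.2 t.2 /\ ~ R0 (t.1.1.2 j) t.1.2 t.2)).
    apply: Def_all_lt => j _; apply: Def_and; [|apply: Def_not];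
      (apply: R0D; last exact: cmap_snd).
    * by apply: (cmap_app (g := fun t => t.1.1.1)); do 3!apply: cmap_fst.
    * by apply: cmap_snd; apply: cmap_fst.
    * apply: (cmap_app (g := fun t => t.1.1.2)); apply: cmap_snd.
      by do 2!apply: cmap_fst.
    * by apply: cmap_snd; apply: cmap_fst.
  + exists a2 => j _ /=; rewrite /R0; split; first by apply/Hc; rewrite odd_double.
    by move/Hc; rewrite /= odd_double.
  + exists g; split=> //; exists x => i lt_in; rewrite /R1 /=.
    have [lt_jn E] : i./2 < n /\ (odd i + i./2.*2 = i).
      split; last exact: odd_double_half.
      by apply: leq_ltn_trans lt_in; rewrite leq_half_double leqW // -addnn leq_addr.
    have [H1 H2] := Hx _ lt_jn; rewrite /= in H1 H2.
    by move: E; case: (odd i) => /= <-; rewrite ?add1n ?add0n; split.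
- case: (n2 _ _ _ R1D) => n; apply.
  apply: (indisc_shatters (c := c') (a := b') (g := id)) => // i.
  exact: (Hc' i.+1 i (ltnSn i)).
Qed.

End Indiscernibles.

(** * NIP of a theory and NIP relations in the monster model *)

Lemma shatters_transfer (S : Type) (L : language S) (M N : structure L) X Y (phi : formula L (X ++ Y)) :
  (forall sigma, satisfies M sigma -> satisfies N sigma) ->
  (forall n, shatters (fun a b => @holds _ _ M _ phi (env_cat a b)) n) ->
  forall n, shatters (fun a b => @holds _ _ N _ phi (env_cat a b)) n.
Proof.
move=> MN Sh n; have [sigma Hs] := shatters_sentence phi n.
by apply: (shattersW (leqnSn n)); apply/Hs; apply: MN; apply/Hs; exact: Sh.
Qed.

Lemma infinite_shatters A B (R : A -> B -> Prop) (a : nat -> A) (b : set nat -> B) :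
  (forall i I, R (a i) (b I) <-> I i) -> forall n, shatters R n.
Proof. by move=> H n; exists a => I; exists (b I). Qed.

Section Transfer.

Variables (S : Type) (L : language S) (kappa : Type) (U : structure L).
Hypothesis F_small : small kappa [set: {X : seq S & formula L X}].
Hypothesis kappa_lim : strong_limit kappa.
Hypothesis U_sat : saturated kappa U.

Lemma Def_shatters_infinite T Z {C : Crd U T} (R : T * env U Z -> Prop) :
  Def R -> (forall n, shatters (fun x y => R (x, y)) n) ->
  exists X (phi : formula L (X ++ Z)) (v : forall s, var X s -> T -> U s),
    (forall t z, R (t, z) <-> holds phi (env_cat (tuple_at v t) z)) /\
    exists (a : nat -> env U X) (b : set nat -> env U Z),
      forall i I, holds phi (env_cat (a i) (b I)) <-> I i.
Proof.
move=> /Def_split[X [phi [v [_ H]]]] Sh; exists X, phi, v; split=> //.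
apply: (shatters_infinite F_small kappa_lim U_sat) => n.
have [a Ha] := Sh n; exists (fun i => tuple_at v (a i)) => I.
by have [b Hb] := Ha I; exists b => i lt_in; rewrite -Hb // H.
Qed.

Lemma NIP_NIP_context (T : theory L) Z : models U T -> NIP T -> NIP_context U Z.
Proof.
move=> UT nT T0 C R RD; apply: contrapT => /forallNP Sh.
have [|X [phi [v [_ [a [b Hab]]]]]] := Def_shatters_infinite RD.
  by move=> n; apply: contrapT.
by apply: (nT X Z phi U UT); exists a, b.
Qed.

(** By completeness, the sentences expressing that finite sets are shattered pass from any model of
    [T] to [U]. *)
Lemma NIP_context_NIP (T : theory L) :
  complete T -> models U T -> (forall Z, NIP_context U Z) -> NIP T.
Proof.
move=> [_ Tc] UT nU X Y phi M MT [a [b Hab]].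
have [|n] := nU Y (env U X) _ (fun p => holds phi (env_cat p.1 p.2)).
  apply: (Def_comp (P := fun t => holds phi t)
    (g := fun p => env_cat p.1 p.2)) (Def_holds _ phi).
  by apply: cmap_cat; [exact: cmap_fst|exact: cmap_snd].
apply; apply: (shatters_transfer (M := M)) => [sigma Ms|].
  by have [|/(_ M MT)] := Tc sigma; [apply|move=> /(_ Ms)].
exact: infinite_shatters (fun i I => Hab i I).
Qed.

(** * The structure induced on a sort *)

Section InducedStructure.

Variable D : S.

Let LD := induced_language L D.
Let UD := induced U D.

(** Tuples of the induced structure get coordinates in [U], so that [Def] on them means definable in
    [U] and the two notions of definability can be compared. *)
Inductive induced_crd_rel (Z : seq unit) : forall s, (env UD Z -> U s) -> Prop :=
  InducedCrd (x : var Z tt) : induced_crd_rel (fun e => lookup x e : U D).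

#[local] Instance induced_crd Z : Crd U (env UD Z) := @induced_crd_rel Z.

Lemma cmap_induced T {C : Crd U T} Z (g : T -> env UD Z) :
  (forall x : var Z tt, crd (fun t => lookup x (g t) : U D)) -> cmap g.
Proof. by move=> gC s f fC; case: s f / fC => x; exact: gC. Qed.

Lemma induced_lookup T {C : Crd U T} Z (g : T -> env UD Z) (x : var Z tt) :
  cmap g -> crd (fun t => lookup x (g t) : U D).
Proof. by move=> gC; exact: (gC D (fun e => lookup x e) (InducedCrd x)). Qed.

Lemma cmap_induced_cat T {C : Crd U T} X Y (g : T -> env UD X) (h : T -> env UD Y) :
  cmap g -> cmap h -> cmap (fun t => env_cat (g t) (h t)).
Proof.
move=> gC hC; apply: (@cmap_induced T C (X ++ Y)) => x; move: x.
suff H : forall u (x : var (X ++ Y) u),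
    @crd S L U T C D (fun t => lookup x (env_cat (g t) (h t))) by exact: H.
apply: var_cat_case => -[] x.
  by under eq_fun do rewrite lookup_catl; exact: induced_lookup.
by under eq_fun do rewrite lookup_catr; exact: induced_lookup.
Qed.

Lemma cmap_induced_pull X Y (r : forall s, var X s -> var Y s) :
  cmap (fun e : env UD Y => pull r e).
Proof.
apply: cmap_induced => x; under eq_fun do rewrite lookup_pull.
exact: InducedCrd.
Qed.

Lemma cmap_env_of_unit n :
  cmap (fun e : env UD (nseq n tt) => env_of_unit (U := U) (D := D) e).
Proof.
apply: cmap_env; elim: n => [|n IH] s x; first by case: (var_nil_case x).
move: s x; apply: (@var_cons_case S D (nseq n D)) => [|s x] /=.
  exact: (InducedCrd (VZ tt (nseq n tt))).
have : exists2 f, f = (fun e => lookup x (env_of_unit (n := n) e)) &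
    induced_crd_rel f by exists (fun e => lookup x (env_of_unit e)) => //; exact: IH.
move=> [f Ef fC]; have -> : (fun e : env UD (nseq n.+1 tt) =>
    lookup x (env_of_unit (n := n) e.2)) = (fun e => f e.2) by rewrite Ef.
case: s f / fC {x Ef} => x; exact: (InducedCrd (VS tt x)).
Qed.

Lemma env_of_unit_surj n (e : env U (nseq n D)) :
  exists e' : env UD (nseq n tt), env_of_unit e' = e.
Proof.
elim: n e => [[]|n IH [a e]]; first by exists tt.
by have [e' <-] := IH e; exists (a, e').
Qed.

Lemma crd_eval_induced X u (t : term LD X u) :
  crd (fun e : env UD X => eval e t : U D).
Proof.
case: u / t => [[] x|[]].
exact: (InducedCrd x).
Qed.

Lemma cmap_evals_induced X Y (ts : terms LD X Y) :
  cmap (fun e : env UD X => evals e ts : env UD Y).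
Proof.
apply: cmap_induced => x; move: x.
suff H : forall u (x : var Y u),
    @crd S L U _ (@induced_crd X) D (fun e => lookup x (evals e ts)) by exact: H.
elim: ts => [|v W t ts IH] u x; first by case: (var_nil_case x).
move: u x; apply: (@var_cons_case unit v W) => [|u x] /=.
  exact: crd_eval_induced.
exact: IH.
Qed.

Lemma Def_induced X (phi : formula LD X) : Def (fun e : env UD X => holds phi e).
Proof.
elim: phi => {X} [X [] t u|X r ts|X|X p Hp q Hq|X [] p Hp] /=.
- by apply: Def_eq; apply: cmap_sort; exact: crd_eval_induced.
- apply: (Def_comp (P := fun e => holds (projT2 r) e)
    (g := fun e : env UD X => env_of_unit (n := projT1 r)
            (evals (M := UD) e ts : env UD (nseq (projT1 r) tt))))
    (Def_holds _ (projT2 r)).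
  exact: cmap_comp (cmap_evals_induced ts) (@cmap_env_of_unit _).
- exact: Def_False.
- exact: Def_imp.
- apply: (Def_all_sort (s := D) (P := fun t => @holds _ _ UD _ p (t.2, t.1))).
  apply: (Def_comp (P := fun e => holds p e)
    (g := fun t : env UD X * U D => (t.2, t.1) : env UD (tt :: X))) Hp.
  apply: cmap_induced => x; move: x.
  suff H : forall u (x : var (tt :: X) u),
      @crd S L U _ (prod_crd (@induced_crd X) (@sort_crd S L U D)) D
        (fun t => @lookup _ UD _ _ x (t.2, t.1)) by exact: H.
  apply: (@var_cons_case unit tt X) => [|[] x] /=.
    by right; exists id => //; exact: CrdSort.
  by left; exists (fun e => lookup x e) => //; exact: InducedCrd.
Qed.

(** The defining formula, with its variables renamed into a block [nseq k D], is itself a relation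
    symbol of the induced language; so an atomic formula is enough. *)
Lemma induced_formula Z (P : env UD Z -> Prop) : Def P ->
  exists psi : formula LD Z, forall e, holds psi e <-> P e.
Proof.
move=> [X [phi [v [vC H]]]].
suff [k [r [ts E]]] : exists k (r : forall s, var X s -> var (nseq k D) s)
    (ts : terms LD Z (nseq k tt)),
    forall e, tuple_at v e = pull r (env_of_unit (evals (M := UD) e ts)).
  exists (@FRel _ LD Z (existT _ k (fren phi r)) ts) => e /=.
  by rewrite holds_fren -E H.
elim: X v vC {phi H} => [|s X IH] v vC.
  by exists 0, (fun s x => match var_nil_case x with end), (TNil LD Z).
have [k [r [ts E]]] := IH (fun t x => v t (VS s x)) (fun t x => vC _ _).
(* That [u] is the sort [D] is known only through [InducedCrd], so the variable of sort [u] is found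
   by cases on it. *)
have head u (f : env UD Z -> U u) : induced_crd_rel f ->
    exists (x : var Z tt) (r0 : var (nseq k.+1 D) u),
    forall e (w : env U (nseq k D)),
    lookup r0 ((lookup x e : U D, w) : env U (nseq k.+1 D)) = f e.
  by case=> x; exists x, (VZ D (nseq k D)).
have [x [r0 E0]] := head s _ (vC s (VZ s X)).
exists k.+1, (@var_cons_case S s X (fun u _ => var (nseq k.+1 D) u) r0
  (fun u y => VS D (r u y))), (TCons (Var LD x) ts) => e.
apply: (@env_ext S U (s :: X)); apply: (@var_cons_case S s X) => [|u y].
  by rewrite lookup_at lookup_pull /= E0.
by rewrite lookup_pull /= -lookup_pull -E !lookup_at.
Qed.

(** Stable embeddedness replaces the points, which may lie in any sorts, by tuples from [D] that
    have the same traces on [D ^ n]. The independent family then lives in the induced structure. *)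
Lemma stably_embedded_NIP_context n :
  stably_embedded U D -> NIP (Th UD) -> NIP_context U (nseq n D).
Proof.
move=> SE nD T C R RD; apply: contrapT => /forallNP Sh.
have [|X [phi [v [_ [a [b Hab]]]]]] := Def_shatters_infinite RD.
  by move=> k; apply: contrapT.
have [m [dphi Hd]] := SE X n phi.
pose a' i := projT1 (cid (Hd (a i))).
have Ha' i d : holds phi (env_cat (a i) d) <-> holds dphi (env_cat (a' i) d).
  by rewrite /a'; case: cid => /= c; exact.
have [|psi Hpsi] := @induced_formula (nseq m tt ++ nseq n tt) (fun e => holds dphi
    (env_cat (env_of_unit (pull (fun s => @vinl _ (nseq m tt) (nseq n tt) s) e))
             (env_of_unit (pull (fun s => @vinr _ (nseq m tt) (nseq n tt) s) e)))).
  apply: (Def_comp (P := fun e => holds dphi e) (g := fun e =>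
    (env_cat (env_of_unit (pull (fun s => @vinl _ (nseq m tt) (nseq n tt) s) e))
             (env_of_unit (pull (fun s => @vinr _ (nseq m tt) (nseq n tt) s) e)))))
    (Def_holds _ dphi).
  by apply: cmap_cat;
    apply: cmap_comp (cmap_induced_pull _) (@cmap_env_of_unit _).
apply: (nD _ _ psi UD) => //.
exists (fun i => projT1 (cid (env_of_unit_surj (a' i)))),
  (fun I => projT1 (cid (env_of_unit_surj (b I)))) => i I.
rewrite Hpsi pull_vinl pull_vinr; case: cid => x /= ->; case: cid => y /= ->.
by rewrite -Ha' Hab.
Qed.

(** A model of the full theory of the induced structure satisfies no further sentences, so
    shattering in it occurs in the induced structure too, where it is shattering by a definable
    relation of [U]. *)
Lemma NIP_context_induced :
  (forall Z, NIP_context U Z) -> NIP (Th UD).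
Proof.
move=> nU X Y phi M MT [a [b Hab]].
pose toUD := fix toUD (W : seq unit) : env U [seq D | _ <- W] -> env UD W :=
  match W return env U [seq D | _ <- W] -> env UD W with
  | [::] => fun _ => tt
  | _ :: W' => fun e => (e.1, toUD W' e.2)
  end.
have toUDC W : cmap (toUD W).
  apply: cmap_induced => x; move: x.
  suff H : forall u (x : var W u),
      @crd S L U _ (@env_crd S L U _) D (fun e => lookup x (toUD W e)) by exact: H.
  elim: W => [|w W IH] u x; first by case: (var_nil_case x).
  move: u x; apply: (@var_cons_case unit w W) => [|u x] /=.
    by exists (VZ D [seq D | _ <- W]).
  by have [y Ey] := IH u x; exists (VS D y); apply/funext => e /=;
    have := congr1 (@^~ e.2) Ey.
have toUDS W (e : env UD W) : exists e', toUD W e' = e.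
  elim: W e => [[]|w W IH [x e]]; first by exists tt.
  by have [e' <-] := IH e; exists (x, e').
have [|n] := nU [seq D | _ <- Y] (env UD X) _
    (fun p => @holds _ _ UD _ phi (env_cat p.1 (toUD Y p.2))).
  apply: (Def_comp (P := fun e => holds phi e)
    (g := fun p => env_cat p.1 (toUD Y p.2))) (Def_induced phi).
  apply: cmap_induced_cat; first exact: cmap_fst.
  by apply: cmap_comp (toUDC Y); exact: cmap_snd.
apply.
have MU sigma : satisfies M sigma -> satisfies UD sigma.
  move=> Ms; apply: contrapT => Us.
  by have /(_ Ms) := MT (FNot sigma) Us.
have Sh := infinite_shatters (R := fun a b => @holds _ _ M _ phi (env_cat a b)) Hab.
have [c Hc] := shatters_transfer MU Sh n.
exists c => I; have [d Hd] := Hc I; have [e Ee] := toUDS Y d.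
by exists e => i lt_in; rewrite /= Ee Hd.
Qed.

End InducedStructure.

End Transfer.

(** * Changing the value of one name *)

Section Update.

Variables (S : Type) (L : language S) (U : structure L) (V : S -> Type).

(** Two names can be compared only together with their sorts, hence the equality of dependent pairs
    and the transport of the value. *)
Definition upd (e : asg U V) s0 (v0 : V s0) (u : U s0) : asg U V :=
  fun s v => match pselect (existT V s0 v0 = existT V s v) with
  | left E => eq_rect (existT V s0 v0) (fun p => U (projT1 p)) u (existT V s v) E
  | right _ => e s v
  end.

Lemma upd_same e s0 (v0 : V s0) u : upd e v0 u v0 = u.
Proof. by rewrite /upd; case: pselect => // E; rewrite (Prop_irrelevance E erefl). Qed.

Lemma upd_other e s0 (v0 : V s0) u s (v : V s) :
  existT V s0 v0 <> existT V s v -> upd e v0 u v = e s v.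
Proof. by rewrite /upd; case: pselect. Qed.

Lemma cmap_upd T {C : Crd U T} (g : T -> asg U V) s0 (v0 : V s0) (k : T -> U s0) :
  cmap g -> cmap k -> cmap (fun t => upd (g t) v0 (k t)).
Proof.
move=> gC kC; apply: cmap_asg => s v.
have [E|ne] := pselect (existT V s v = existT V s0 v0).
  apply: (existT_transport (Q := fun s v =>
    @crd S L U T C s (fun t => upd (g t) v0 (k t) v)) E).
  by under eq_fun do rewrite upd_same; exact: crd_sort.
have -> : (fun t => upd (g t) v0 (k t) v) = (fun t => g t s v).
  by apply/funext => t; rewrite upd_other // => E; apply: ne.
by apply: crd_sort; exact: cmap_asg_app.
Qed.

Lemma env_map_upd e s0 (v0 : V s0) u X (w : env V X) :
  (forall s (x : var X s), existT V s0 v0 <> existT V s (lookup x w)) ->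
  env_map (upd e v0 u) w = env_map e w.
Proof.
by move=> H; apply: env_ext => s x; rewrite !lookup_map upd_other.
Qed.

Fixpoint nseq_var n (s : S) (j : nat) : option (var (nseq n s) s) :=
  match n return option (var (nseq n s) s) with
  | 0 => None
  | n'.+1 => if j is j'.+1 then omap (fun x => VS s x) (nseq_var n' s j')
             else Some (VZ s (nseq n' s))
  end.

Fixpoint nseq_env s n (f : nat -> U s) : env U (nseq n s) :=
  match n return env U (nseq n s) with
  | 0 => tt
  | n'.+1 => (f 0, nseq_env n' (fun j => f j.+1))
  end.

Lemma nseq_varP s n (f : nat -> U s) j : j < n ->
  exists2 x, nseq_var n s j = Some x & lookup x (nseq_env n f) = f j.
Proof.
elim: n j f => // n IH [|j] f jn /=; first by exists (VZ s (nseq n s)).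
by have [x -> E] := IH j (fun j => f j.+1) jn; exists (VS s x).
Qed.

End Update.

(** * Alternating sequences and the extension of their terms *)

Section Alternation.

Variables (S : Type) (L : language S) (kappa : Type) (U : structure L).
Hypothesis F_small : small kappa [set: {X : seq S & formula L X}].
Hypothesis U_sat : saturated kappa U.
Variables (V : S -> Type) (X0 : seq S).
Hypothesis V_codable : codable L {s & V s}.
Variable eta : env U X0 * asg U V -> Prop.
Hypothesis eta_Def : Def eta.

(** Neither [b] nor [c] is fixed, since extending the terms replaces both. *)
Definition alternates (chi : env U X0 * asg U V -> Prop) : Prop :=
  exists b c, indisc c /\
    forall i : nat, chi (b, c i.*2) /\ eta (b, c i.*2.+1).

Lemma alternates_sub (chi chi' : env U X0 * asg U V -> Prop) :
  (forall p, chi p -> chi' p) -> alternates chi -> alternates chi'.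
Proof.
move=> sub [b [c [ci H]]]; exists b, c; split=> // i.
by have [/sub] := H i.
Qed.

Lemma alternates_extract (chi : env U X0 * asg U V -> Prop) (c : nat -> asg U V) :
  Def chi ->
  (forall n h, inc h -> exists g, inc g /\ exists b, forall i, i < n ->
     chi (b, c (h (g i.*2))) /\ eta (b, c (h (g i.*2.+1)))) ->
  alternates chi.
Proof.
move=> chiD H.
have [||n|m n t mn K i im|n h hI|b [c' [ci K]]] := indisc_extract F_small U_sat
  (c := c) (Q := fun n t => forall i, i < n ->
    chi (t.1, t.2 i.*2) /\ eta (t.1, t.2 i.*2.+1)).
- exact: presentable_asg.
- exact: presentable_env.
- apply: Def_all_lt => i _; apply: Def_and.
    apply: (Def_comp (P := chi) (g := fun t => (t.1, t.2 i.*2))) chiD.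
    by apply: cmap_pair; [exact: cmap_fst|apply: cmap_app; exact: cmap_snd].
  apply: (Def_comp (P := eta) (g := fun t => (t.1, t.2 i.*2.+1))) eta_Def.
  by apply: cmap_pair; [exact: cmap_fst|apply: cmap_app; exact: cmap_snd].
- by apply: K; exact: leq_trans mn.
- exact: H.
- by exists b, c'; split=> // i; exact: (K i.+1 i (ltnSn i)).
Qed.

Section Extension.

Variables (chi chi' : env U X0 * asg U V -> Prop) (s : S) (v : V s).
Hypothesis chi_Def : Def chi.
Hypothesis chi'_Def : Def chi'.
Hypothesis eta_v : forall b e u, eta (b, e) -> eta (b, upd e v u).

(** The new value depends on the term alone, so one function attaches it to even and odd terms
    alike. A parameter that alternates along a given subsequence comes from the indiscernibility of
    the old sequence. *)
Lemma alternates_extend :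
  (forall e, exists u, forall b, chi (b, e) -> chi' (b, upd e v u)) ->
  alternates chi -> alternates chi'.
Proof.
move=> H [b [c [ci Hc]]]; pose u e := projT1 (cid (H e)).
have Hu e b' : chi (b', e) -> chi' (b', upd e v (u e)).
  by rewrite /u; case: cid => x /= Hx; exact: Hx.
apply: (alternates_extract (c := fun i => upd (c i) v (u (c i)))) => // n h hI.
exists id; split; first exact: inc_id.
pose P (y : nat -> asg U V) := exists b', forall i, i < n ->
  chi (b', y i.*2) /\ eta (b', y i.*2.+1).
have PD : Def P.
  apply: (Def_ex_env (P := fun t => forall i, i < n ->
    chi (t.2, t.1 i.*2) /\ eta (t.2, t.1 i.*2.+1))).
  apply: Def_all_lt => i _; apply: Def_and.
    apply: (Def_comp (P := chi) (g := fun t => (t.2, t.1 i.*2))) chi_Def.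
    by apply: cmap_pair; [exact: cmap_snd|apply: cmap_app; exact: cmap_fst].
  apply: (Def_comp (P := eta) (g := fun t => (t.2, t.1 i.*2.+1))) eta_Def.
  by apply: cmap_pair; [exact: cmap_snd|apply: cmap_app; exact: cmap_fst].
have : P c by exists b => i _.
move=> /(ci P PD h hI)[b' Hb']; exists b' => i lt_in.
by have [/Hu ? ?] := Hb' i lt_in; split=> //; exact: eta_v.
Qed.

(** The new value depends on [b] too and exists at even terms only. The new sequence consists of the
    even terms with their values, and [exchange] turns some of them into odd ones. Its data are the
    values at [n] terms, so relations have to be NIP against any number of variables of sort [s]. *)
Lemma alternates_extend_NIP :
  (forall n, NIP_context U (nseq n s)) ->
  (forall b e, chi (b, e) -> exists u, chi' (b, upd e v u)) ->
  alternates chi -> alternates chi'.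
Proof.
move=> nips H [b [c [ci Hc]]].
have Hu i : exists u, chi' (b, upd (c i.*2) v u) by apply: H; case: (Hc i).
pose u i := projT1 (cid (Hu i)).
apply: (alternates_extract (c := fun i => upd (c i.*2) v (u i))) => // n h hI.
(* [nseq_var] is partial; the default branch does not occur for [j < n]. *)
pose updo (e : asg U V) (w : env U (nseq n s)) o :=
  if o is Some x then upd e v (lookup x w) else e.
have [|e o eo|g [gI [b' Hb']]] := exchange (c := c)
  (w := fun e => nseq_env n (fun j => u (e j))) (h := h)
  (R := fun t => exists b, forall j, j < n ->
    chi' (b, updo (t.1.1 j) t.2 (nseq_var n s j)) /\ eta (b, t.1.2 j))
  (nips n) _ ci hI.
- apply: (Def_ex_env (P := fun t => forall j, j < n ->
    chi' (t.2, updo (t.1.1.1 j) t.1.2 (nseq_var n s j)) /\ eta (t.2, t.1.1.2 j))).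
  apply: Def_all_lt => j _; apply: Def_and.
    apply: (Def_comp (P := chi') (g := fun t =>
      (t.2, updo (t.1.1.1 j) t.1.2 (nseq_var n s j)))) chi'_Def.
    apply: cmap_pair; first exact: cmap_snd.
    rewrite /updo; case: (nseq_var n s j) => [x|].
      apply: cmap_upd.
        by apply: (cmap_app (g := fun t => t.1.1.1)); do 3!apply: cmap_fst.
      by apply: cmap_lookup; apply: cmap_snd; apply: cmap_fst.
    by apply: (cmap_app (g := fun t => t.1.1.1)); do 3!apply: cmap_fst.
  apply: (Def_comp (P := eta) (g := fun t => (t.2, t.1.1.2 j))) eta_Def.
  apply: cmap_pair; first exact: cmap_snd.
  by apply: (cmap_app (g := fun t => t.1.1.2)); apply: cmap_snd; do 2!apply: cmap_fst.
- exists b => j jn /=; have [x -> /= ->] := nseq_varP (fun j => u (e j)) jn.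
  split; last by case: (Hc (o j)).
  by rewrite /u; case: cid.
- exists g; split=> //; exists b' => i lt_in.
  have [] := Hb' i lt_in; have [x -> /= ->] := nseq_varP
    (fun j => u (h (g j.*2))) lt_in.
  by split=> //; exact: eta_v.
Qed.

End Extension.

End Alternation.

(** * Henkin constants along an alternating sequence *)

Section Terms.

Variables (S : Type) (L : language S) (Y : seq S).

Fixpoint terms_env X (ts : terms L Y X) : env (term L Y) X :=
  match ts in terms _ _ X return env (term L Y) X with
  | TNil => tt
  | TCons _ _ t ts' => (t, terms_env ts')
  end.

Fixpoint env_terms X : env (term L Y) X -> terms L Y X :=
  match X return env (term L Y) X -> terms L Y X with
  | [::] => fun _ => TNil L Y
  | _ :: _ => fun w => TCons w.1 (env_terms w.2)
  end.

Lemma env_termsK X (w : env (term L Y) X) : terms_env (env_terms w) = w.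
Proof. by elim: X w => [[]//|s X IH [t w]] /=; rewrite IH. Qed.

Fixpoint height s (t : term L Y s) : nat :=
  match t with Var _ _ => 0 | App _ ts => (heights ts).+1 end
with heights X (ts : terms L Y X) : nat :=
  match ts with TNil => 0 | TCons _ _ t ts' => maxn (height t) (heights ts') end.

Lemma height_lookup X (ts : terms L Y X) s (x : var X s) :
  height (lookup x (terms_env ts)) <= heights ts.
Proof.
elim: ts s x => [|u W t ts IH] s x; first by case: (var_nil_case x).
move: s x; apply: (@var_cons_case S u W) => [|s x] /=; rewrite leq_max ?leqnn //.
by rewrite IH orbT.
Qed.

Definition app_of s (t : term L Y s) : option {f : func L & terms L Y (fdom f)} :=
  match t with Var _ _ => None | App f ts => Some (existT _ f ts) end.

Lemma App_inj (j k : {f : func L & terms L Y (fdom f)}) :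
  existT (term L Y) _ (App (projT2 j)) = existT (term L Y) _ (App (projT2 k)) ->
  j = k.
Proof.
case: j k => [f ts] [g us] /= /(congr1 (fun p => app_of (projT2 p))) /=.
by case.
Qed.

Lemma terms_cons_inv s X (ts : terms L Y (s :: X)) :
  exists t ts', ts = TCons t ts'.
Proof.
have H W (us : terms L Y W) : match W return terms L Y W -> Prop with
    | [::] => fun _ => True
    | s' :: X' => fun us => exists (t : term L Y s') (ts' : terms L Y X'),
        us = TCons t ts'
    end us by case: us => // s' X' t ts'; exists t, ts'.
exact: (H _ ts).
Qed.

Lemma terms_nil_inv (ts : terms L Y [::]) : ts = TNil L Y.
Proof.
have H W (us : terms L Y W) : match W return terms L Y W -> Prop with
    | [::] => fun us => us = TNil L Y
    | _ :: _ => fun _ => True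
    end us by case: us.
exact: (H _ ts).
Qed.

Variable L' : language S.
Variable cf : func L -> sentence L'.
Hypothesis cf_inj : injective cf.

Fixpoint code_term s (t : term L Y s) : sentence L' :=
  match t with
  | Var _ x => FImp FBot (code_nat L' (vidx x))
  | App f ts => FImp (FNot FBot) (FImp (cf f) (code_terms ts))
  end
with code_terms X (ts : terms L Y X) : sentence L' :=
  match ts with
  | TNil => FBot
  | TCons _ _ t ts' => FImp (code_term t) (code_terms ts')
  end.

Lemma code_nat_inj : injective (code_nat L').
Proof. by elim=> [|n IH] [|m] //= /FImp_inj[_ /IH ->]. Qed.

Lemma code_term_inj s (t : term L Y s) : forall s' (t' : term L Y s'),
  code_term t = code_term t' -> existT (term L Y) s t = existT (term L Y) s' t'.
Proof.
move: s t; apply: (@term_mut S L Y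
  (fun s t => forall s' (t' : term L Y s'), code_term t = code_term t' ->
     existT (term L Y) s t = existT (term L Y) s' t')
  (fun X ts => forall ts' : terms L Y X, code_terms ts = code_terms ts' -> ts = ts')).
- move=> u x s' [s'' y|f ts] /= /FImp_inj[] // _ /code_nat_inj E.
  have {}E := vidx_inj E.
  by apply: (existT_transport (Q := fun u x =>
    existT (term L Y) u (Var L x) = existT (term L Y) s'' (Var L y)) E).
- move=> f ts IH s' [s'' y|g us] /= /FImp_inj[] // _ /FImp_inj[/cf_inj fg].
  by move: us; case: g / fg => us /IH ->.
- by move=> ts' _; rewrite (terms_nil_inv ts').
- move=> v X u IHt ts IHts ts'; have [w [us ->]] := terms_cons_inv ts'.
  move=> /= /FImp_inj[/IHt E /IHts ->].
  by rewrite (existT_inj E).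
Qed.

Lemma codable_term : codable L' {s & term L Y s}.
Proof.
exists (fun p => code_term (projT2 p)) => -[s t] [s' t'] /= E.
exact: code_term_inj.
Qed.

End Terms.

Section Henkin.

Variables (S : Type) (L : language S) (kappa : Type) (U : structure L).
Hypothesis F_small : small kappa [set: {X : seq S & formula L X}].
Hypothesis U_sat : saturated kappa U.

(* [s0] is the sort of the element whose type is studied, and [D] the set of
   sorts against which every relation is NIP. *)
Variables (s0 : S) (D : set S).
Hypothesis D_NIP : forall s, D s -> forall n, NIP_context U (nseq n s).

(* Skolem functions: those of the second kind also depend on the element of
   sort [s0]. *)
Definition skolem_language : language S := @Language S
  ({i : S * seq S & formula L (i.1 :: i.2)} +
   {i : S * seq S & formula L (i.1 :: s0 :: i.2)})
  (fun f => match f with inl g => (projT1 g).2 | inr g => (projT1 g).2 end)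
  (fun f => match f with inl g => (projT1 g).1 | inr g => (projT1 g).1 end)
  Empty_set (fun _ => [::]).

Lemma codable_shape (I : Type) (sh : I -> seq S) :
  injective sh -> codable L {i : I & formula L (sh i)}.
Proof.
move=> sh_inj; apply: (codable_inj (f := fun p =>
  existT (formula L) (sh (projT1 p)) (projT2 p))) (codable_formula L).
move=> [i p] [j q] /= E.
suff : forall k (Ek : sh i = sh k),
    existT (fun i => formula L (sh i)) k (eq_rect (sh i) (formula L) p (sh k) Ek) =
    existT (fun i => formula L (sh i)) j q by move=> /(_ i erefl).
apply: (existT_transport (Q := fun Z p => forall k (Ek : Z = sh k),
    existT (fun i => formula L (sh i)) k (eq_rect Z (formula L) p (sh k) Ek) =
    existT (fun i => formula L (sh i)) j q) E) => k Ek.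
have jk := sh_inj _ _ Ek; move: Ek; case: k / jk => Ek.
by rewrite (Prop_irrelevance Ek erefl).
Qed.

Variable Y : seq S.

Local Notation HV := (term skolem_language Y).
Local Notation A := (asg U HV).
Local Notation B := (env U [:: s0]).
Definition skolem_app := {f : func skolem_language & terms skolem_language Y (fdom f)}.

Lemma codable_HV : codable L {s & HV s}.
Proof.
have [cf cf_inj] : codable L (func skolem_language).
  by apply: codable_sum; apply: codable_shape => -[s X] [s' X'] /= [-> ->].
exact: codable_term cf_inj.
Qed.

(** The Henkin axiom that makes [v] the Skolem term for [p] at the arguments [w]. *)
Definition chooses s X (p : formula L (s :: X)) (w : env HV X) (v : HV s)
    (q : B * A) : Prop :=
  forall z, @holds _ _ U (s :: X) p (z, env_map q.2 w) ->
  @holds _ _ U (s :: X) p (q.2 s v, env_map q.2 w).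

(** The axiom is empty for sorts outside [D], so that all Skolem symbols of the second kind can be
    treated alike. *)
Definition chooses_over s X (p : formula L (s :: s0 :: X)) (w : env HV X)
    (v : HV s) (q : B * A) : Prop :=
  D s -> forall z, @holds _ _ U (s :: s0 :: X) p (z, (q.1.1, env_map q.2 w)) ->
  @holds _ _ U (s :: s0 :: X) p (q.2 s v, (q.1.1, env_map q.2 w)).

Lemma chooses_Def s X (p : formula L (s :: X)) (w : env HV X) (v : HV s) :
  Def (chooses p w v).
Proof.
pose f (t : (B * A) * U s) : env U (s :: X) := (t.2, env_map t.1.2 w).
pose g (t : (B * A) * U s) : env U (s :: X) := (t.1.2 s v, env_map t.1.2 w).
have tC : cmap (fun t : (B * A) * U s => env_map t.1.2 w).
  by apply: cmap_env_map; apply: cmap_snd; apply: cmap_fst.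
have fC : cmap f by apply: cmap_cons => //; exact: cmap_snd.
have gC : cmap g.
  apply: cmap_cons => //.
  apply: (cmap_asg_app (V := HV) (g := fun t : (B * A) * U s => t.1.2)).
  by apply: cmap_snd; apply: cmap_fst.
apply: (Def_all_sort (s := s) (P := fun t => holds p (f t) -> holds p (g t))).
by apply: Def_imp; [exact: (Def_comp fC (Def_holds _ p))|
  exact: (Def_comp gC (Def_holds _ p))].
Qed.

Lemma chooses_over_Def s X (p : formula L (s :: s0 :: X)) (w : env HV X)
  (v : HV s) : Def (chooses_over p w v).
Proof.
pose f (t : (B * A) * U s) : env U (s :: s0 :: X) :=
  (t.2, (t.1.1.1, env_map t.1.2 w)).
pose g (t : (B * A) * U s) : env U (s :: s0 :: X) :=
  (t.1.2 s v, (t.1.1.1, env_map t.1.2 w)).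
have tC : @cmap S L U _ (env U (s0 :: X)) _ _ (fun t : (B * A) * U s =>
    (t.1.1.1, env_map t.1.2 w)).
  apply: cmap_cons; first by apply: (@cmap_head _ _ _ _ _ [::]); do 2!apply: cmap_fst.
  by apply: cmap_env_map; apply: cmap_snd; apply: cmap_fst.
have fC : cmap f by apply: cmap_cons tC; exact: cmap_snd.
have gC : cmap g.
  apply: cmap_cons tC.
  apply: (cmap_asg_app (V := HV) (g := fun t : (B * A) * U s => t.1.2)).
  by apply: cmap_snd; apply: cmap_fst.
apply: Def_imp; first exact: Def_cst.
apply: (Def_all_sort (s := s) (P := fun t => holds p (f t) -> holds p (g t))).
by apply: Def_imp; [exact: (Def_comp fC (Def_holds _ p))|
  exact: (Def_comp gC (Def_holds _ p))].
Qed.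

Lemma chooses_eq s X (p : formula L (s :: X)) (w : env HV X) (v : HV s) b e e' :
  env_map e' w = env_map e w -> e' s v = e s v ->
  chooses p w v (b, e) -> chooses p w v (b, e').
Proof. by move=> E F; rewrite /chooses /= E F. Qed.

Lemma chooses_over_eq s X (p : formula L (s :: s0 :: X)) (w : env HV X) (v : HV s)
  b e e' : env_map e' w = env_map e w -> e' s v = e s v ->
  chooses_over p w v (b, e) -> chooses_over p w v (b, e').
Proof. by move=> E F; rewrite /chooses_over /= E F. Qed.

Lemma chooses_upd s X (p : formula L (s :: X)) (w : env HV X) (v : HV s) e :
  (forall u, env_map (upd e v u) w = env_map e w) ->
  exists u, forall b, chooses p w v (b, upd e v u).
Proof.
move=> E; have [[z Hz]|noz] := pselect (exists z, @holds _ _ U (s :: X) p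
    (z, env_map e w)).
  by exists z => b y _; rewrite /= E upd_same.
by exists (e s v) => b y; rewrite /= E => Hy; case: noz; exists y.
Qed.

Lemma chooses_over_upd s X (p : formula L (s :: s0 :: X)) (w : env HV X)
  (v : HV s) b e : (forall u, env_map (upd e v u) w = env_map e w) ->
  exists u, chooses_over p w v (b, upd e v u).
Proof.
move=> E; have [[z Hz]|noz] := pselect (exists z, @holds _ _ U (s :: s0 :: X) p
    (z, (b.1, env_map e w))).
  by exists z => _ y _; rewrite /= E upd_same.
by exists (e s v) => _ y; rewrite /= E => Hy; case: noz; exists y.
Qed.

Definition henkin (j : skolem_app) : B * A -> Prop :=
  match j with existT f ts => match f return
    terms skolem_language Y (@fdom S skolem_language f) -> B * A -> Prop with
  | inl g => fun ts => chooses (s := (projT1 g).1) (projT2 g) (terms_env ts)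
      (App (L := skolem_language) (f := inl g) ts)
  | inr g => fun ts => chooses_over (s := (projT1 g).1) (projT2 g) (terms_env ts)
      (App (L := skolem_language) (f := inr g) ts)
  end ts end.

Lemma henkin_Def j : Def (henkin j).
Proof. by case: j => [[g|g] ts]; [exact: chooses_Def|exact: chooses_over_Def]. Qed.

Definition skolem_var (j : skolem_app) : HV (fcod (projT1 j)) := App (projT2 j).

(** The arguments of [k] have smaller height than [k], hence than [j], so a change of the value at
    [j] does not affect the axiom of [k]. *)
Lemma henkin_upd (j k : skolem_app) (b : B) (e : A) u : height (skolem_var k) <= height (skolem_var j) ->
  j <> k -> henkin k (b, e) -> henkin k (b, upd e (skolem_var j) u).
Proof.
move=> le_kj ne.
have E : env_map (upd e (skolem_var j) u) (terms_env (projT2 k)) =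
    env_map e (terms_env (projT2 k)).
  apply: env_map_upd => s x /(congr1 (fun p => height (projT2 p))) /= Eh.
  have := height_lookup (projT2 k) x; rewrite -Eh.
  by move=> /(leq_trans le_kj); rewrite ltnn.
have F : upd e (skolem_var j) u (skolem_var k) = e _ (skolem_var k).
  by apply: upd_other => /App_inj.
case: k {le_kj ne} E F => [[g|g] ts] E F.
  exact: chooses_eq E F.
exact: chooses_over_eq E F.
Qed.

Lemma henkin_args (j : skolem_app) (e : A) u :
  env_map (upd e (skolem_var j) u) (terms_env (projT2 j)) =
  env_map e (terms_env (projT2 j)).
Proof.
apply: env_map_upd => s x /(congr1 (fun p => height (projT2 p))) /= Eh.
by have := height_lookup (projT2 j) x; rewrite -Eh ltnn.
Qed.

Variable phi0 : B * A -> Prop.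
Hypothesis phi0_Def : Def phi0.
Hypothesis phi0_upd : forall j b e u, phi0 (b, upd e (skolem_var j) u) <-> phi0 (b, e).
Hypothesis phi0_alternates :
  alternates (fun p => ~ phi0 p) phi0.

Definition henkin_for (l : list skolem_app) p := phi0 p /\ forall j, List.In j l -> henkin j p.

(** Lists are treated from their end, so names of small height receive their values first and later
    changes do not disturb their axioms. *)
Fixpoint decreasing (l : list skolem_app) : Prop :=
  if l is j :: l' then
    (forall k, List.In k l' -> height (skolem_var k) <= height (skolem_var j)) /\ decreasing l'
  else True.

Lemma decreasing_insert j l : decreasing l ->
  exists l', decreasing l' /\ forall k, List.In k l' <-> (k = j \/ List.In k l).
Proof.
elim: l => [|k l IH] /=; first by exists [:: j]; split=> // k; split=> -[]; left.
move=> [kl /[dup] ld /IH[l' [l'd H]]].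
have [kj|/ltnW jk] := leqP (height (skolem_var k)) (height (skolem_var j)).
  exists (j :: k :: l); split=> [|i /=]; last by split=> -[->|]; [left|right|left|right].
  by split=> // i /= [<-//|/kl /leq_trans]; apply.
exists (k :: l'); split=> /= [|i].
  by split=> // i /H[->//|]; exact: kl.
rewrite H; split=> [[->|[->|]]|[->|[->|]]]; tauto.
Qed.

(** A Skolem term of the first kind takes its value from the term of the sequence alone, one of the
    second kind also from [b]. These are the two ways to extend an alternation, and the second one
    requires the sort to be in [D]. *)
Lemma alternates_henkin (l : list skolem_app) :
  alternates (fun p => ~ phi0 p) (henkin_for l).
Proof.
have [l' [l'd ll']] : exists l', decreasing l' /\
    forall k, List.In k l -> List.In k l'.
  elim: l => [|j l [l' [l'd ll']]]; first by exists [::].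
  have [l'' [l''d H]] := decreasing_insert j l'd; exists l''; split=> // k /= kl.
  by apply/H; case: kl => [->|/ll']; [left|right].
apply: (@alternates_sub _ _ _ _ _ _ (henkin_for l')) => [p [p0 H]|].
  by split=> // j /ll'; exact: H.
elim: l' l'd {ll'} => [_|j l' IH /= [jl' l'd]].
  by apply: alternates_sub phi0_alternates => p p0; split.
have axD k : Def (henkin_for k).
  by apply: Def_and => //; apply: Def_list => i _; exact: henkin_Def.
have [jin|jnin] := pselect (List.In j l').
  by apply: alternates_sub (IH l'd) => p [p0 H]; split=> // k /= [<-|]; exact: H.
have keep b e u : henkin_for l' (b, e) -> henkin j (b, upd e (skolem_var j) u) ->
    henkin_for (j :: l') (b, upd e (skolem_var j) u).
  move=> [p0 H] Hj; split=> [|k /= [<-//|kl']]; first exact/phi0_upd.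
  by apply: henkin_upd; [exact: jl'|move=> E; apply: jnin; rewrite E|exact: H].
have nD : Def (fun p : B * A => ~ phi0 p) by exact: Def_not.
have eta_upd k b e u : ~ phi0 (b, e) -> ~ phi0 (b, upd e (skolem_var k) u).
  by rewrite phi0_upd.
have args (e : A) u := @henkin_args j e u.
have ext1 : (forall e, exists u, forall b, henkin j (b, upd e (skolem_var j) u)) ->
    alternates (fun p => ~ phi0 p) (henkin_for (j :: l')).
  move=> H; apply: (alternates_extend F_small U_sat codable_HV nD (axD l') (axD _)
    (@eta_upd j)) (IH l'd) => e.
  by have [u Hu] := H e; exists u => b K; exact: keep K (Hu b).
have ext2 : D (fcod (projT1 j)) ->
    (forall b e, exists u, henkin j (b, upd e (skolem_var j) u)) ->
    alternates (fun p => ~ phi0 p) (henkin_for (j :: l')).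
  move=> Dj H; apply: (alternates_extend_NIP F_small U_sat codable_HV nD (axD _)
    (@eta_upd j) (D_NIP Dj)) (IH l'd) => b e K.
  by have [u Hu] := H b e; exists u; exact: keep K Hu.
case: j {jl' jnin keep} args ext1 ext2 => [[g|g] ts] args ext1 ext2.
- by apply: ext1 => e; exact: (chooses_upd (projT2 g) (args e)).
- have [Ds|nDs] := pselect (D (projT1 g).1).
    by apply: ext2 => // b e; exact: (chooses_over_upd (projT2 g) b (args e)).
  (* Outside [D] the axiom is vacuous, and the old value is kept. *)
  apply: ext1 => e; exists (e _ (skolem_var (existT _ (inr g) ts))) => b.
  by move=> Ds; case: (nDs Ds).
Qed.

(** The form in which NIP of a formula is used: its truth value is eventually constant along
    indiscernible sequences. One implication suffices, as [i] and [j] can be exchanged. *)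
Definition NIP_relation (P : B * A -> Prop) : Prop :=
  Def P /\ forall b c, indisc c ->
    exists m, forall i j, m <= i -> m <= j -> P (b, c i) -> P (b, c j).

(* The relations in [l] that hold at [p] do not imply [phi0]. *)
Definition wild (l : list {P | NIP_relation P}) (p : B * A) : Prop :=
  (forall P, List.In P l -> sval P p) ->
  exists b', (forall P, List.In P l -> sval P (b', p.2)) /\ ~ phi0 (b', p.2).

Lemma wild_Def l : Def (wild l).
Proof.
apply: Def_imp; first by apply: Def_list => -[P [PD ?]] _.
apply: (Def_ex_env (P := fun t => (forall P, List.In P l -> sval P (t.2, t.1.2)) /\
  ~ phi0 (t.2, t.1.2))).
have C : cmap (fun t : (B * A) * B => (t.2, t.1.2)).
  by apply: cmap_pair; [exact: cmap_snd|apply: cmap_snd; exact: cmap_fst].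
apply: Def_and.
  by apply: Def_list => -[P [PD ?]] _; exact: (Def_comp (P := P) C PD).
by apply: Def_not; exact: (Def_comp (P := phi0) C).
Qed.

(** For large [i], the relations that hold at an even term also hold at the next odd term, where
    [phi0] fails. That some [b'] behaves in this way is a property of a single term, so by
    indiscernibility it holds at the even term as well. *)
Lemma wild_eventually b c l : indisc c -> (forall i : nat, ~ phi0 (b, c i.*2.+1)) ->
  exists m, forall i, m <= i -> wild l (b, c i.*2).
Proof.
move=> ci nphi.
have [m Hm] : exists m, forall i j, m <= i -> m <= j ->
    forall P, List.In P l -> sval P (b, c i) -> sval P (b, c j).
  elim: l => [|P l [m Hm]]; first by exists 0.
  have [_ /(_ b c ci)[m' Hm']] := svalP P.
  exists (maxn m m') => i j; rewrite !geq_max => /andP[mi m'i] /andP[mj m'j].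
  by move=> Q /= [<-|Ql]; [exact: Hm'|exact: (Hm i j)].
exists m => i mi Pl.
pose P (y : nat -> A) := exists b', (forall P, List.In P l -> sval P (b', y 0)) /\
  ~ phi0 (b', y 0).
have PD : Def P.
  have C : cmap (fun t : (nat -> A) * B => (t.2, t.1 0)).
    apply: cmap_pair; first exact: cmap_snd.
    by apply: cmap_app; exact: cmap_fst.
  apply: (Def_ex_env (P := fun t => (forall P, List.In P l -> sval P (t.2, t.1 0)) /\
    ~ phi0 (t.2, t.1 0))).
  apply: Def_and.
    by apply: Def_list => -[Q [QD ?]] _; exact: (Def_comp (P := Q) C QD).
  by apply: Def_not; exact: (Def_comp (P := phi0) C).
have shift k : inc (fun i => k + i) by move=> x y xy; rewrite ltn_add2l.
have := indisc_eq ci PD (shift i.*2.+1) (shift i.*2).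
rewrite /P !addn0; apply; exists b; split; last exact: nphi.
move=> Q Ql; apply: (Hm i.*2) (Pl Q Ql) => //.
  by apply: leq_trans mi _; rewrite -addnn leq_addr.
by apply: leqW; apply: leq_trans mi _; rewrite -addnn leq_addr.
Qed.

(** Any finitely many conditions hold at an even term far enough in a suitable sequence: the Henkin
    axioms and [phi0] hold at all its even terms, the conditions [wild] from some point on. *)
Theorem henkin_completion : exists b e,
  [/\ forall j, henkin j (b, e), phi0 (b, e) & forall l, wild l (b, e)].
Proof.
pose I := (skolem_app + (unit + list {P | NIP_relation P}))%type.
pose Sigma (i : I) : B * A -> Prop := match i with
  | inl j => henkin j | inr (inl _) => phi0 | inr (inr l) => wild l end.
have [||l|[b e] H] := compactness_presentable F_small U_sat (Sigma := Sigma).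
- apply: presentable_prod; first exact: presentable_env.
  exact: presentable_asg codable_HV.
- by case=> [j|[_|l]] //=; [exact: henkin_Def|exact: wild_Def].
- pose l1 := List.flat_map (fun i : I => if i is inl j then [:: j] else [::]) l.
  have [b [c [ci Hc]]] := alternates_henkin l1.
  have odd_phi i := (Hc i).2.
  have [m Hm] : exists m, forall i, List.In i l ->
      if i is inr (inr k) then forall n, m <= n -> wild k (b, c n.*2) else True.
    elim: l {l1 Hc} => [|i l [m Hm]]; first by exists 0.
    case: i => [j|[t|k]]; try by exists m => i /= [<-//|]; exact: Hm.
    have [m' Hm'] := wild_eventually k ci odd_phi.
    exists (maxn m m') => i /= [<- n|/Hm]; first by rewrite geq_max => /andP[_]; exact: Hm'.
    by case: i => [|[|k']] // H n; rewrite geq_max => /andP[/H].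
  have [[p0 Hp] _] := Hc m.
  exists (b, c m.*2) => -[j|[t|k]] il //=; last exact: (Hm _ il m).
  by apply: Hp; apply/List.in_flat_map; exists (inl j); split=> //; left.
- exists b, e; split=> [j||k].
  + exact: (H (inl j)).
  + exact: (H (inr (inl tt))).
  + exact: (H (inr (inr k))).
Qed.

Variables (b : B) (e : A).
Hypothesis be_henkin : forall j, henkin j (b, e).

(** The definable condition reads finitely many names. The Skolem symbol of its formula, applied to
    these names, is a name for a witness. *)
Lemma henkin_witness s (P : A * U s -> Prop) : Def P -> (exists z, P (e, z)) ->
  exists v : HV s, P (e, @e s v).
Proof.
move=> PD [z Pz].
have P'D : Def (fun p : A * env U [:: s] => P (p.1, p.2.1)).
  apply: (Def_comp (P := P) (g := fun p : A * env U [:: s] => (p.1, p.2.1))) PD.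
  apply: cmap_pair; first exact: cmap_fst.
  by apply: (@cmap_head _ _ _ _ _ [::]); exact: cmap_snd.
have [X [psi [w [wC H]]]] := Def_split_rev P'D.
pose args : env HV X := env_tab (fun s x => projT1 (cid (wC s x))).
have E : tuple_at w e = env_map e (terms_env (env_terms args)).
  rewrite env_termsK; apply: env_ext => u x.
  by rewrite lookup_at lookup_map lookup_tab; case: cid => y /= ->.
exists (App (L := skolem_language) (f := inl (existT _ (s, X) psi)) (env_terms args)).
have /= K := be_henkin (existT _ (inl (existT _ (s, X) psi)) (env_terms args)).
apply/(H e ((_ : U s), tt)); rewrite /= E; apply: (K z).
by rewrite -E; apply/(H e (z, tt)).
Qed.

Lemma henkin_witness_NIP s (P : (B * A) * U s -> Prop) : D s -> Def P ->
  (exists z, P ((b, e), z)) -> exists v : HV s, P ((b, e), @e s v).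
Proof.
move=> Ds PD [z Pz].
have P'D : Def (fun p : A * env U [:: s; s0] => P (((p.2.2.1, tt), p.1), p.2.1)).
  apply: (Def_comp (P := P) (g := fun p : A * env U [:: s; s0] =>
    ((((p.2.2.1, tt) : B), p.1), p.2.1))) PD.
  apply: cmap_pair; last by apply: (@cmap_head _ _ _ _ _ [:: s0]); exact: cmap_snd.
  apply: cmap_pair; last exact: cmap_fst.
  apply: cmap_cons => //; apply: (@cmap_head _ _ _ _ _ [::]).
  by apply: (@cmap_tail _ _ _ _ _ [:: s0]); exact: cmap_snd.
have [X [psi [w [wC H]]]] := Def_split_rev P'D.
pose args : env HV X := env_tab (fun s x => projT1 (cid (wC s x))).
have E : tuple_at w e = env_map e (terms_env (env_terms args)).
  rewrite env_termsK; apply: env_ext => u x.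
  by rewrite lookup_at lookup_map lookup_tab; case: cid => y /= ->.
exists (App (L := skolem_language) (f := inr (existT _ (s, X) psi)) (env_terms args)).
have /= K := be_henkin (existT _ (inr (existT _ (s, X) psi)) (env_terms args)).
have Eb : b = (b.1, tt) by case: b => ? [].
rewrite Eb; apply/(H e ((_ : U s), (b.1, tt))); rewrite /= E; apply: (K Ds z).
by rewrite -E; apply/(H e (z, (b.1, tt))); rewrite /= -Eb.
Qed.

End Henkin.

(** * The elementary substructure of named elements *)

Section Witnesses.

Variables (S : Type) (L : language S) (U : structure L).

Fixpoint var_terms X G : (forall s, var X s -> var G s) -> terms L G X :=
  match X return (forall s, var X s -> var G s) -> terms L G X with
  | [::] => fun _ => TNil L G
  | s :: X' => fun r => TCons (Var L (r s (VZ s X'))) (var_terms (fun t x => r t (VS s x)))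
  end.

Lemma evals_var_terms X G (r : forall s, var X s -> var G s) (e : env U G) :
  evals e (var_terms r) = pull r e.
Proof. by elim: X r => //= s X IH r; rewrite IH. Qed.

Lemma Def_fint T {C : Crd U T} (f : func L) (g : T -> U (fcod f))
  (h : T -> env U (fdom f)) : cmap g -> cmap h -> Def (fun t => g t = fint (h t)).
Proof.
move=> gC hC.
pose phi : formula L (fcod f :: fdom f) := FEq (Var L (VZ (fcod f) (fdom f)))
  (App (var_terms (fun s x => VS (fcod f) x))).
apply: (Def_ext (P := fun t => @holds _ _ U (fcod f :: fdom f) phi (g t, h t))).
  move=> t /=; rewrite evals_var_terms (_ : pull _ _ = h t) //.
  by apply: env_ext => s x; rewrite lookup_pull.
apply: (Def_comp (P := fun e => holds phi e)
  (g := fun t => (g t, h t) : env U (fcod f :: fdom f))) (Def_holds _ phi).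
exact: cmap_cons.
Qed.

Variables (V : S -> Type) (e : asg U V).

(** The Tarski-Vaught test for the set of named elements. *)
Definition has_witnesses : Prop :=
  forall s (P : asg U V * U s -> Prop), Def P -> (exists z, P (e, z)) ->
  exists v : V s, P (e, @e s v).

Hypothesis eW : has_witnesses.

Let N s := {u : U s | exists v : V s, @e s v = u}.

Let N_args X (a : env N X) :
  exists w : env V X, env_map (fun s u => sval u) a = env_map e w.
Proof.
elim: X a => [[]|s X IH [[u [v Ev]] a]]; first by exists tt.
by have [w E] := IH a; exists (v, w); rewrite /= E Ev.
Qed.

(** The value of [f] is the only solution of a definable condition over names, so it is named. *)
Let N_fint (f : func L) (a : env N (fdom f)) :
  {u : N (fcod f) | sval u = fint (env_map (fun s u => sval u) a)}.
Proof.
apply: cid; have [w ->] := N_args a.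
have [||v Ev] := eW (s := fcod f) (P := fun p => p.2 = fint (env_map p.1 w)).
- apply: Def_fint; first exact: cmap_snd.
  by apply: cmap_env_map; exact: cmap_fst.
- by exists (fint (env_map e w)).
- by exists (exist _ (@e _ v) (ex_intro _ v erefl)).
Qed.

(** The embedding is elementary by the Tarski-Vaught test. The injection into the names is there to
    bound the size of the substructure. *)
Lemma witnesses_elementary :
  exists (M : structure L) (j : forall s, M s -> U s),
    [/\ elementary_embedding j, forall s, range (j s) = range (@e s)
      & exists g : {s & M s} -> {s & V s}, injective g].
Proof.
pose M : structure L := @Structure S L N (fun f a => sval (N_fint a))
  (fun r a => rint (env_map (fun s u => sval u) a)).
pose j s (u : M s) := sval u.
exists M, j; split.
- have ev X (a : env M X) s (t : term L X s) : j s (eval a t) = eval (env_map j a) t.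
    move: s t; apply: (@term_mut S L X
      (fun s t => j s (eval a t) = eval (env_map j a) t)
      (fun Z ts => env_map j (evals a ts) = evals (env_map j a) ts)) => //=.
    + by move=> s x; rewrite lookup_map.
    + by move=> f ts <-; rewrite /j; case: N_fint => u /= ->.
    + by move=> s Z t -> ts ->.
  have evs X (a : env M X) Z (ts : terms L X Z) :
      env_map j (evals a ts) = evals (env_map j a) ts.
    by elim: ts => //= s W t ts ->; rewrite ev.
  have j_inj s (u u' : M s) : j s u = j s u' -> u = u'.
    case: u u' => [u Hu] [u' Hu']; rewrite /j /= => E.
    by case: u' / E Hu' => Hu'; rewrite (Prop_irrelevance Hu Hu').
  move=> X phi; elim: phi => {X}.
  + move=> X s t u a /=; rewrite -!ev.
    by split=> [->//|/j_inj].
  + by move=> X r ts a /=; rewrite -evs.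
  + by [].
  + by move=> X p IHp q IHq a /=; rewrite IHp IHq.
  + move=> X s p IH a /=; split=> [H z|H z]; last by apply/IH; exact: H.
    apply: contrapT => nz; have [w Ew] := N_args a.
    have [||v] := eW (s := s) (P := fun q => ~ @holds _ _ U (s :: X) p (q.2, env_map q.1 w)).
    * apply: Def_not; apply: (Def_comp (P := fun e => holds p e)
        (g := fun q => (q.2, env_map q.1 w) : env U (s :: X))) (Def_holds _ p).
      apply: cmap_cons; first exact: cmap_snd.
      by apply: cmap_env_map; exact: cmap_fst.
    * by exists z; rewrite /= -Ew.
    * apply; rewrite /= -Ew.
      exact/(IH (exist _ (@e s v) (ex_intro _ v erefl), a))/H.
- move=> s; apply/seteqP; split=> u.
    by move=> [[u' [v Ev]] _ <-]; exists v.
  by move=> [v _ Ev]; exists (exist _ u (ex_intro _ v Ev)).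
- exists (fun p => existT V (projT1 p) (projT1 (cid (svalP (projT2 p))))).
  move=> [s [u Hu]] [s' [u' Hu']] /=; case: cid => v /= Ev; case: cid => v' /= Ev'.
  move=> E; suff : forall u (Hu : exists v, @e s v = u), @e s v = u ->
      existT M s (exist _ u Hu) = existT M s' (exist _ u' Hu') by exact.
  apply: (existT_transport (Q := fun s v => forall u (Hu : exists v, @e s v = u),
    @e s v = u -> existT M s (exist _ u Hu) = existT M s' (exist _ u' Hu')) E).
  move=> w Hw Ew; congr existT.
  have uw : u' = w by rewrite -Ew.
  by case: w / uw Hw {Ew} => Hw; rewrite (Prop_irrelevance Hw Hu').
Qed.

End Witnesses.

(** * NIP formulas along indiscernible sequences *)

Section Relations.

Variables (S : Type) (L : language S) (kappa : Type) (U : structure L).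
Hypothesis F_small : small kappa [set: {X : seq S & formula L X}].
Hypothesis kappa_lim : strong_limit kappa.
Hypothesis U_sat : saturated kappa U.

(** If the truth value changed infinitely often, it would alternate along a subsequence, and finite
    sets of terms of [c] would be shattered. Duality makes them the parameters, as in [phi] the
    variable of sort [s0] comes first. *)
Lemma NIP_formula_relation (T : theory L) (s0 : S) (Y Z : seq S)
  (phi : formula L ([:: s0] ++ Z)) (w : env (term (skolem_language L s0) Y) Z) :
  models U T -> NIP_formula T phi ->
  NIP_relation (fun q : env U [:: s0] * asg U (term (skolem_language L s0) Y) =>
    holds phi (env_cat q.1 (env_map q.2 w))).
Proof.
move=> UT nphi; set P := fun q => _.
have PD : Def P.
  apply: (Def_comp (P := fun e => holds phi e)
    (g := fun q => env_cat q.1 (env_map q.2 w))) (Def_holds _ phi).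
  apply: cmap_cat; first exact: cmap_fst.
  by apply: cmap_env_map; exact: cmap_snd.
split=> // b c ci; apply: contrapT => /forallNP H.
have inf (i m : nat) : exists j, m <= j /\ (P (b, c j) <-> ~~ odd i).
  apply: contrapT => /forallNP K; apply: (H m) => j k mj mk Pj.
  case oi: (odd i) K => K; last by case: (K j); split=> //; split.
  by apply: contrapT => nPk; case: (K k); split.
have [g [gI Hg]] := inc_choice inf.
have RD : Def (fun q => P (q.2, q.1)).
  apply: (Def_comp (P := P) (g := fun q => (q.2, q.1))) PD.
  by apply: cmap_pair; [exact: cmap_snd|exact: cmap_fst].
have Sh := shatters_dual (indisc_shatters RD ci gI Hg).
have [|a [p Hap]] := shatters_infinite F_small kappa_lim U_sat (phi := phi).
  move=> n; have [a Ha] := Sh n; exists a => I; have [e He] := Ha I.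
  by exists (env_map e w) => i lt_in; rewrite -He.
by apply: (nphi U UT); exists a, p.
Qed.

End Relations.

(** * Immediate extensions of valued fields *)

Section ValuedFields.

Variables (E : language vf_sort) (M : structure (vf_language E)).
Hypothesis M_vf : valued_field M.

Lemma vf_mul_inj (x y z : M VF) :
  vf_mul x y = vf_one M -> vf_mul x z = vf_one M -> y = z.
Proof.
have [F [k [G [v [r [iF [ik [iG [_ [[bF _ _] [[_ F1 _ _ FM] _]]]]]]]]]]] := M_vf.
move=> xy xz; apply: (bij_inj bF).
have := congr1 iF xy; have := congr1 iF xz; rewrite !FM F1 => xz' xy'.
have x0 : iF x != 0%R.
  by apply/eqP => x0; move/eqP: xz'; rewrite x0 GRing.mul0r eq_sym GRing.oner_eq0.
by apply: (GRing.mulfI x0); rewrite xy' xz'.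
Qed.

Lemma vf_val_surj (g : M VG) : exists x, x <> vf_zero M /\ vf_val x = g.
Proof.
have [F [k [G [v [r [iF [ik [iG [vr [[bF _ bG] [[F0 _ _ _ _] [_ [_ [Hv _]]]]]]]]]]]]]] := M_vf.
have [x x0 vx] := val_surj vr (iG g).
have [jF jFK FK] := bF; exists (jF x); split.
  by move=> jx; move/eqP: x0; apply; rewrite -F0 -jx FK.
by apply: (bij_inj bG); rewrite Hv FK vx.
Qed.

Lemma vf_res_surj (c : M RF) :
  exists x, vg_le (vg_zero M) (vf_val x) /\ vf_res x = c.
Proof.
have [F [k [G [v [r [iF [ik [iG [vr [[bF bk bG] [_ [_ [[G0 _ _ Gle] [Hv Hr]]]]]]]]]]]]]] := M_vf.
have [x x0 rx] := res_surj vr (ik c).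
have [jF jFK FK] := bF; exists (jF x); split.
  by apply/Gle; rewrite G0 Hv FK.
by apply: (bij_inj bk); rewrite Hr FK rx.
Qed.

End ValuedFields.

Section ImmediateExtension.

Variables (E : language vf_sort) (U : structure (vf_language E)).
Hypothesis U_vf : valued_field U.
Variables (V : vf_sort -> Type) (b : env U [:: VF]) (e : asg U V).

Local Notation q := (b, e).
Local Notation Q := (env U [:: VF] * asg U V)%type.

Hypothesis e_wit : has_witnesses e.
Hypothesis e_wit_NIP : forall s (P : Q * U s -> Prop), s <> VF -> Def P ->
  (exists z, P (q, z)) -> exists v : V s, P (q, @e s v).

Let K := range (@e VF).
Let K' := subfield (K `|` [set b.1]).

Let Def_vf T {C : Crd U T} (f : func (vf_language E)) (g : T -> U (fcod f))
  (h : T -> env U (fdom f)) : cmap g -> cmap h -> Def (fun t => g t = fint (h t)).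
Proof. exact: Def_fint. Qed.

(** Membership of [y] in the definable closure of [b] and the named elements. *)
Let definable_over s (y : U s) :=
  exists2 P : Q * U s -> Prop, Def P & forall z, P (q, z) <-> z = y.

Let definable_in y : definable_over (s := VF) y ->
  forall s (P : (Q * U VF) * U s -> Prop) z0, Def P ->
  (forall z, P ((q, y), z) <-> z = z0) -> definable_over z0.
Proof.
move=> [Py PyD Hy] s' P z0 PD HP.
exists (fun p => exists y, Py (p.1, y) /\ P ((p.1, y), p.2)).
  apply: (Def_ex_sort (P := fun t => Py (t.1.1, t.2) /\ P ((t.1.1, t.2), t.1.2))).
  have C1 : cmap (fun t : (Q * U s') * U VF => t.1.1).
    by apply: cmap_fst; exact: cmap_fst.
  have C2 : cmap (fun t : (Q * U s') * U VF => t.2) by exact: cmap_snd.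
  apply: Def_and.
    by apply: (Def_comp (P := Py) (g := fun t => (t.1.1, t.2))) PyD; exact: cmap_pair.
  apply: (Def_comp (P := P) (g := fun t => ((t.1.1, t.2), t.1.2))) PD.
  apply: cmap_pair; first exact: cmap_pair.
  by apply: cmap_snd; exact: cmap_fst.
move=> z; rewrite -HP; split=> [[y' [/Hy -> //]]|Hz].
by exists y; split=> //; exact/Hy.
Qed.

Lemma definable_subfield y : K' y -> definable_over (s := VF) y.
Proof.
have c2 T (C : Crd U T) (f g : T -> U VF) : cmap f -> cmap g ->
    @cmap _ _ U T (env U [:: VF; VF]) _ _ (fun t => (f t, (g t, tt))).
  by move=> fC gC; do 2!apply: cmap_cons => //.
have c1 T (C : Crd U T) (f : T -> U VF) : cmap f ->
    @cmap _ _ U T (env U [:: VF]) _ _ (fun t => (f t, tt)).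
  by move=> fC; apply: cmap_cons.
elim=> {y}.
- move=> x [[v _ <-]|->].
    exists (fun p => p.2 = p.1.2 VF v) => //.
    apply: Def_eq; first exact: cmap_snd.
    by apply: (cmap_asg_app (V := V) (g := fun p : Q * U VF => p.1.2));
      apply: cmap_snd; exact: cmap_fst.
  exists (fun p => p.2 = p.1.1.1) => //.
  apply: Def_eq; first exact: cmap_snd.
  by apply: (@cmap_head _ _ _ _ _ [::]); apply: cmap_fst; exact: cmap_fst.
- exists (fun p => p.2 = vf_zero U) => //.
  apply: (Def_vf (f := inl VF0) (g := fun p : Q * U VF => p.2)); first exact: cmap_snd.
  exact: cmap_nil.
- exists (fun p => p.2 = vf_one U) => //.
  apply: (Def_vf (f := inl VF1) (g := fun p : Q * U VF => p.2)); first exact: cmap_snd.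
  exact: cmap_nil.
- move=> x y _ [Px PxD Hx] _ dy.
  apply: (definable_in dy (P := fun t => exists x, Px (t.1.1, x) /\
    t.2 = vf_add x t.1.2)).
    apply: (Def_ex_sort (P := fun t => Px (t.1.1.1, t.2) /\ t.1.2 = vf_add t.2 t.1.1.2)).
    apply: Def_and.
      apply: (Def_comp (P := Px) (g := fun t => (t.1.1.1, t.2))) PxD.
      by apply: cmap_pair; [do 3!apply: cmap_fst|exact: cmap_snd].
    apply: (Def_vf (f := inl VFadd) (g := fun t => t.1.2)
      (h := fun t : ((Q * U VF) * U VF) * U VF => (t.2, (t.1.1.2, tt)))).
      by apply: cmap_snd; exact: cmap_fst.
    apply: c2; first exact: cmap_snd.
    by apply: cmap_snd; do 2!apply: cmap_fst.
  move=> z /=; split=> [[x' [/Hx -> ->]]//|->].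
  by exists x; split=> //; exact/Hx.
- move=> x _ dx.
  apply: (definable_in dx (P := fun t => t.2 = vf_opp t.1.2)) => //.
  apply: (Def_vf (f := inl VFopp) (g := fun t => t.2)
    (h := fun t : (Q * U VF) * U VF => (t.1.2, tt))); first exact: cmap_snd.
  by apply: c1; apply: cmap_snd; exact: cmap_fst.
- move=> x y _ [Px PxD Hx] _ dy.
  apply: (definable_in dy (P := fun t => exists x, Px (t.1.1, x) /\
    t.2 = vf_mul x t.1.2)).
    apply: (Def_ex_sort (P := fun t => Px (t.1.1.1, t.2) /\ t.1.2 = vf_mul t.2 t.1.1.2)).
    apply: Def_and.
      apply: (Def_comp (P := Px) (g := fun t => (t.1.1.1, t.2))) PxD.
      by apply: cmap_pair; [do 3!apply: cmap_fst|exact: cmap_snd].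
    apply: (Def_vf (f := inl VFmul) (g := fun t => t.1.2)
      (h := fun t : ((Q * U VF) * U VF) * U VF => (t.2, (t.1.1.2, tt)))).
      by apply: cmap_snd; exact: cmap_fst.
    apply: c2; first exact: cmap_snd.
    by apply: cmap_snd; do 2!apply: cmap_fst.
  move=> z /=; split=> [[x' [/Hx -> ->]]//|->].
  by exists x; split=> //; exact/Hx.
(* The inverse is definable as the only solution of its equation. *)
- move=> x y _ dx xy.
  apply: (definable_in dx (P := fun t => exists w, w = vf_one U /\
    w = vf_mul t.1.2 t.2)).
    apply: (Def_ex_sort (P := fun t => t.2 = vf_one U /\ t.2 = vf_mul t.1.1.2 t.1.2)).
    apply: Def_and.
      apply: (Def_vf (f := inl VF1) (g := fun t : ((Q * U VF) * U VF) * U VF => t.2)).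
        exact: cmap_snd.
      exact: cmap_nil.
    apply: (Def_vf (f := inl VFmul) (g := fun t => t.2)
      (h := fun t : ((Q * U VF) * U VF) * U VF => (t.1.1.2, (t.1.2, tt)))).
      exact: cmap_snd.
    by apply: c2; [apply: cmap_snd; do 2!apply: cmap_fst|apply: cmap_snd; exact: cmap_fst].
  move=> z /=; split=> [[w [-> /esym xz]]|->]; first exact: vf_mul_inj xz xy.
  by exists (vf_one U).
Qed.

(** The value and the residue of an element of [K'] are definable over [b] and the names, and their
    sorts are not [VF], so they are named. Since the valuation and the residue map are onto, each is
    the image of a named field element. *)
Lemma immediate_witnesses : immediate K K'.
Proof.
have c1 T (C : Crd U T) (f : T -> U VF) : cmap f ->
    @cmap _ _ U T (env U [:: VF]) _ _ (fun t => (f t, tt)).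
  by move=> fC; apply: cmap_cons.
have KK' : K `<=` K' by move=> x Kx; apply: subfield_gen; left.
split=> //; apply/seteqP; split.
- move=> _ [y [K'y y0] <-].
  have [P PD HP] : definable_over (s := VG) (vf_val y).
    apply: (definable_in (definable_subfield K'y) (P := fun t => t.2 = vf_val t.1.2)) => //.
    apply: (Def_vf (f := inl Val) (g := fun t => t.2)
      (h := fun t : (Q * U VF) * U VG => (t.1.2, tt))); first exact: cmap_snd.
    by apply: c1; apply: cmap_snd; exact: cmap_fst.
  have [||v /HP /= Ev] := @e_wit_NIP VG P _ PD; first by [].
    by exists (vf_val y); apply/HP.
  have [||x [/= x0 Ex]] := @e_wit VF (fun t => t.2 <> vf_zero U /\ t.1 VG v = vf_val t.2).
  + apply: Def_and.
      apply: Def_not.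
      apply: (Def_vf (f := inl VF0) (g := fun t : asg U V * U VF => t.2)).
        exact: cmap_snd.
      exact: cmap_nil.
    apply: (Def_vf (f := inl Val) (g := fun t : asg U V * U VF => t.1 VG v)
      (h := fun t : asg U V * U VF => (t.2, tt))).
      by apply: (cmap_asg_app (V := V) (g := fun t : asg U V * U VF => t.1)); exact: cmap_fst.
    by apply: c1; exact: cmap_snd.
  + by have [x [x0 Ex]] := vf_val_surj U_vf (@e VG v); exists x.
  + exists (@e VF x); first by split=> //; exists x.
    by rewrite -Ex Ev.
- by move=> _ [x [Kx x0] <-]; exists x => //; split=> //; exact: KK'.
- move=> _ [y [K'y y0] <-].
  have [P PD HP] : definable_over (s := RF) (vf_res y).
    apply: (definable_in (definable_subfield K'y) (P := fun t => t.2 = vf_res t.1.2)) => //.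
    apply: (Def_vf (f := inl Res) (g := fun t => t.2)
      (h := fun t : (Q * U VF) * U RF => (t.1.2, tt))); first exact: cmap_snd.
    by apply: c1; apply: cmap_snd; exact: cmap_fst.
  have [||v /HP /= Ev] := @e_wit_NIP RF P _ PD; first by [].
    by exists (vf_res y); apply/HP.
  have [||x [/= x0 Ex]] := @e_wit VF
    (fun t => vg_le (vg_zero U) (vf_val t.2) /\ t.1 RF v = vf_res t.2).
  + apply: Def_and.
      pose p : formula (vf_language E) [:: VF] := @FRel _ (vf_language E) _ (inl VGle)
        (TCons (@App _ (vf_language E) _ (inl VG0) (TNil _ _))
        (TCons (@App _ (vf_language E) _ (inl Val)
          (TCons (Var _ (VZ VF [::])) (TNil _ _))) (TNil _ _))).
      apply: (Def_comp (P := fun a => holds p a)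
        (g := fun t : asg U V * U VF => (t.2, tt) : env U [:: VF])) (Def_holds _ p).
      by apply: c1; exact: cmap_snd.
    apply: (Def_vf (f := inl Res) (g := fun t : asg U V * U VF => t.1 RF v)
      (h := fun t : asg U V * U VF => (t.2, tt))).
      by apply: (cmap_asg_app (V := V) (g := fun t : asg U V * U VF => t.1)); exact: cmap_fst.
    by apply: c1; exact: cmap_snd.
  + by have [x [x0 Ex]] := vf_res_surj U_vf (@e RF v); exists x.
  + exists (@e VF x); first by split=> //; exists x.
    by rewrite -Ex Ev.
- by move=> _ [x [Kx x0] <-]; exists x => //; split=> //; exact: KK'.
Qed.

End ImmediateExtension.

(** * NIP in one variable of the field sort *)

Section FieldSort.

Variables (E : language vf_sort) (T : theory (vf_language E)).
Variables (kappa : Type) (U : structure (vf_language E)).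
Hypothesis T_vf : forall M : structure (vf_language E), models M T -> valued_field M.
Hypothesis U_monster : monster kappa U T.
Hypothesis RF_NIP : forall n, NIP_context U (nseq n RF).
Hypothesis VG_NIP : forall n, NIP_context U (nseq n VG).
Hypothesis Im : immediate_types_NIP T kappa U.

Local Notation SK := (skolem_language (vf_language E) VF).

Lemma NIP_context_VF : NIP_context U [:: VF].
Proof.
have [F_small kappa_lim UT U_sat _] := U_monster.
have U_vf := T_vf UT.
move=> T0 C R RD; apply: contrapT => /forallNP Sh.
have [|X [phi [_ [_ [a [b0 Hab]]]]]] := Def_shatters_infinite F_small kappa_lim U_sat RD.
  by move=> n; apply: contrapT.
pose V := term SK X.
have V_cod : codable (vf_language E) {s & V s} by exact: codable_HV.
pose base : env V X := env_tab (fun s x => Var SK x).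
pose phi0 (q : env U [:: VF] * asg U V) := holds phi (env_cat (env_map q.2 base) q.1).
have phi0D : Def phi0.
  apply: (Def_comp (P := fun e => holds phi e)
    (g := fun q => env_cat (env_map q.2 base) q.1)) (Def_holds _ phi).
  apply: cmap_cat; last exact: cmap_fst.
  by apply: cmap_env_map; exact: cmap_snd.
(* [phi0] reads the values of variables only, and a Skolem application is not a variable. *)
have phi0_upd (j : skolem_app (vf_language E) VF X) (b : env U [:: VF]) (e : asg U V) u :
    phi0 (b, upd e (skolem_var j) u) <-> phi0 (b, e).
  rewrite /phi0 /= env_map_upd // => s x; rewrite lookup_tab.
  by move=> /(congr1 (fun p => app_of (projT2 p))).
(* An assignment needs a value at every name, so compound terms start with the zero of their sort;
   the Henkin steps replace it. *)
pose u0 s : U s := match s with VF => vf_zero U | RF => rf_zero U | VG => vg_zero U end.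
pose ext (i : nat) : asg U V := fun s v =>
  match v in term _ _ s return U s with
  | Var _ x => lookup x (a i)
  | App f _ => u0 _
  end.
have [|//|b [c [ci Hc]]] := shatters_indisc F_small U_sat (presentable_asg U V_cod)
    (presentable_env U [:: VF]) (R := fun p => phi0 (p.2, p.1)) (a := ext) (b := b0).
  apply: (Def_comp (P := phi0) (g := fun p => (p.2, p.1))) phi0D.
  by apply: cmap_pair; [exact: cmap_snd|exact: cmap_fst].
  move=> i I; rewrite /phi0 /= (_ : env_map (ext i) base = a i) //.
  by apply: env_ext => s x; rewrite lookup_map lookup_tab.
have alt : alternates (fun p => ~ phi0 p) phi0.
  exists b, c; split=> // i; split; first by apply/Hc; rewrite odd_double.
  by move/Hc; rewrite /= odd_double.
have D_NIP s : [set RF; VG] s -> forall n, NIP_context U (nseq n s) by case=> ->.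
have [{ci Hc alt}b [e [Hhen phi_be Hwild]]] :=
  henkin_completion F_small U_sat D_NIP phi0D phi0_upd alt.
have e_wit : has_witnesses e by move=> s P; exact: (henkin_witness Hhen).
have [N [j [el rangej [g g_inj]]]] := witnesses_elementary e_wit.
have N_small : small kappa [set: {s & N s}].
  apply: (small_inj (f := g)); last exact: (small_codable F_small V_cod).
  by move=> x y _ _; exact: g_inj.
have imm : immediate (range (j VF)) (subfield (range (j VF) `|` [set b.1])).
  rewrite rangej; apply: immediate_witnesses => // s P sVF.
  apply: (henkin_witness_NIP Hhen).
  by case: s P sVF => //= _ _; [left|right].
have lift Y (w : env V Y) : exists c : env N Y, env_map j c = env_map e w.
  elim: Y w => [|s Y IH] w; first by exists tt.
  have [c' Ec] := IH w.2; have : range (j s) (e s w.1) by rewrite rangej; exists w.1.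
  by move=> [u _ Eu]; exists (u, c'); rewrite /= Ec Eu.
have lower Y (c' : env N Y) : exists w : env V Y, env_map j c' = env_map e w.
  elim: Y c' => [|s Y IH] c'; first by exists tt.
  have [w Ew] := IH c'.2; have : range (e s) (j s c'.1) by rewrite -rangej; exists c'.1.
  by move=> [v _ Ev]; exists (v, w); rewrite /= Ew Ev.
(* [immediate_types_NIP] expects the field variable in front. *)
have [r Hr] := vswap X [:: VF].
pose phi' : formula (vf_language E) ([:: VF] ++ X) := fren phi r.
have Hphi' (x : U VF) (e' : asg U V) : @holds _ _ U (VF :: X) phi' (x, env_map e' base) <->
    phi0 ((x, tt) : env U [:: VF], e').
  by rewrite holds_fren (Hr _ _ ((x, tt) : env U [:: VF])).
pose A : set {s & U s} := [set p | exists v, e (projT1 p) v = projT2 p].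
(* A realization of this type contradicts (Im): it satisfies the NIP formulas over the model that
   are true of [b], but not [phi']. Finite satisfiability comes from [wild]. *)
pose p : set (pformula U VF) := [set q |
  (exists Y (th : formula (vf_language E) ([:: VF] ++ Y)) (w : env V Y),
    [/\ NIP_formula T th, @holds _ _ U (VF :: Y) th (b.1, env_map e w)
      & q = existT _ Y (th, env_map e w)]) \/
  q = existT _ X (FNot phi', env_map e base)].
have [|q pq|p0 p0p p0fin|a' Ha'] := U_sat A VF p.
- apply: (small_inj (f := fun q : {s & U s} =>
    if pselect (exists v, e (projT1 q) v = projT2 q) is left H
    then Some (existT V (projT1 q) (projT1 (cid H))) else None)).
    move=> [s u] [s' u'] Au Au'; case: pselect => //= H; case: pselect => //= H'.
    case: (cid H) => v /= <-; case: (cid H') => v' /= <- [] _ Ev.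
    by apply: (existT_transport (Q := fun s v => existT U s (e s v) = existT U s' (e s' v')) Ev).
  apply: (small_codable F_small); apply: (codable_inj (f := fun o =>
    match o with None => inl 0 | Some v => inr v end)).
    by move=> [v|] [v'|] // [->].
  exact: codable_sum (codable_nat _) V_cod.
- have Aw Y (w : env V Y) : env_in A (env_map e w).
    by elim: Y w => //= s Y IH w; split; [exists w.1|exact: IH].
  by case: pq => [[Y [th [w [_ _ ->]]]]|->]; exact: Aw.
- have [l0 Hl0] := finite_set_list p0fin.
  (* The NIP formulas occurring in the finite part are collected as a list of NIP relations, to
     which [wild] can be applied. *)
  have [l [Hl1 Hl2]] : exists l : list {P | NIP_relation P},
      (forall P, List.In P l -> sval P (b, e)) /\
      forall b', (forall P, List.In P l -> sval P (b', e)) -> ~ phi0 (b', e) ->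
      forall q, List.In q l0 -> p0 q -> pholds q b'.1.
    elim: l0 {Hl0} => [|q l0 [l [Hl1 Hl2]]]; first by exists [::].
    have [qp0|qp0] := pselect (p0 q); last first.
      by exists l; split=> // b' H1 H2 q' /= [<-//|]; exact: Hl2.
    have [[Y [th [w [nth Hth ->]]]]|->] := p0p _ qp0.
      exists (exist _ _ (NIP_formula_relation F_small kappa_lim U_sat w UT nth) :: l).
      split=> [P /= [<-//|]|b' H1 H2 q' /= [<- _|]]; first exact: Hl1.
        exact: (H1 _ (or_introl erefl)).
      by apply: Hl2 => // P Pl; apply: H1; right.
    exists l; split=> // b' H1 H2 q' /= [<- _|]; last exact: Hl2.
    rewrite /pholds /= => /Hphi'.
    by have -> : ((b'.1, tt) : env U [:: VF]) = b' by case: (b') => ? [].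
  have [b' [H1 H2]] := Hwild l Hl1.
  by exists b'.1 => q qp0; apply: Hl2 => //; exact: Hl0.
- have [c0 Ec0] := lift _ base.
  have := Im N_small el imm (a' := a') _ (psi := phi') (c := c0).
  rewrite Ec0; have /= nphi := Ha' _ (or_intror erefl).
  move=> K; apply: nphi; apply: K => [Y th c' nth Hth|].
    have [w Ew] := lower _ c'; rewrite Ew in Hth *.
    apply: (Ha' (existT _ Y (th, env_map e w))); left.
    by exists Y, th, w.
  apply/Hphi'.
  by have -> : ((b.1, tt) : env U [:: VF]) = b by case: (b) => ? [].
Qed.

End FieldSort.

Theorem theorem2p3 (E : language vf_sort) (T : theory (vf_language E))
    (kappa : Type) (U : structure (vf_language E))
    (T_complete : complete T)
    (T_valued_fields :
       forall M : structure (vf_language E), models M T -> valued_field M)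
    (U_monster : monster kappa U T)
    (SE : stably_embedded U RF /\ stably_embedded U VG)
    (Im : immediate_types_NIP T kappa U) :
  NIP T <-> NIP (Th (induced U RF)) /\ NIP (Th (induced U VG)).
Proof.
have [F_small kappa_lim UT U_sat _] := U_monster.
split=> [nT|[nRF nVG]].
  by split; apply: NIP_context_induced => Z;
    exact: NIP_NIP_context F_small kappa_lim U_sat _ _ UT nT.
have [SERF SEVG] := SE.
have cRF n := stably_embedded_NIP_context F_small kappa_lim U_sat (n := n) SERF nRF.
have cVG n := stably_embedded_NIP_context F_small kappa_lim U_sat (n := n) SEVG nVG.
have cVF := NIP_context_VF T_valued_fields U_monster cRF cVG Im.
apply: (NIP_context_NIP T_complete UT); elim=> [|s Z IH].
  exact: NIP_context_nil.
apply: (NIP_context_cat F_small kappa_lim U_sat (X1 := [:: s])) => //.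
by case: s; [|exact: (cRF 1)|exact: (cVG 1)].
Qed.
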